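(* Let $p$ be a prime, $n\geq 3$ an integer, and let $A$ be the ring defined in the context. Let $R$ be a homomorphic image of $A$ which is not $\mathbb{Z}[x,y]/\left((p)+(x,y)^2\right)$. Let $\mathfrak{a}\lhd \mathbb{Z}[x,y]/(p,x,y)^n$ and $\mu:\mathfrak{a}\to F_p$ be the ideal and the map associated to $R$. Then $R$ is minimal noncommutative if and only if $(\mathfrak{a},\mu)$ is a minimal generating pair.
   Context: All rings are associative with $1$, and subrings contain the identity element. A ring is minimal noncommutative if it is not commutative but all its proper subrings and all its proper homomorphic images (quotients by nonzero two-sided ideals) are commutative. $F_p$ is the field with $p$ elements. The ring $A$: let $\mathbb{Z}\langle x,y\rangle$ be the free associative ring on $x,y$, $[x,y]=xy-yx$, $(p,x,y)$ the two-sided ideal generated by $p,x,y$, and $A=\mathbb{Z}\langle x,y\rangle/(I+(p,x,y)^n)$ where $I=(p,x,y)[x,y]\mathbb{Z}\langle x,y\rangle+\mathbb{Z}\langle x,y\rangle[x,y](p,x,y)$. A homomorphic image of $A$ is a quotient of $A$ by a two-sided ideal; images of $x,y$ are denoted by the same letters. The pair associated to $R$: let $P=\mathbb{Z}[x,y]/(p,x,y)^n$ (commutative polynomial ring modulo the $n$-th power of the ideal $(p,x,y)$). There is an injective homomorphism of abelian groups $\iota:P\to A$ sending (the class of) each monomial $x^sy^t$ to $x^sy^t\in A$. The commutator ideal of $R$ is $([x,y])=\{m[x,y]: m\in F_p\}$ (note $p[x,y]=0$), and the abelianisation $C=R/([x,y])$ is a quotient of $P$ (via $x\mapsto x$, $y\mapsto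 y$); let $\mathfrak{a}$ be the ideal of $P$ with $C=P/\mathfrak{a}$. For $a\in\mathfrak{a}$, the image of $\iota(a)$ in $R$ lies in $\{m[x,y]:m\in F_p\}$. If $[x,y]\neq 0$ in $R$, define $\mu(a)\in F_p$ as the unique scalar such that the image of $\iota(a)$ in $R$ equals $\mu(a)[x,y]$; if $[x,y]=0$ in $R$, let $\mu=0$. Then $\mu:\mathfrak{a}\to F_p$ is a homomorphism of abelian groups, and $(\mathfrak{a},\mu)$ is the pair associated to $R$. Minimal generating pairs (for fixed $p$, $n$): a pair $(\mathfrak{b},\nu)$ is minimal generating if (1) $\mathfrak{b}$ is an ideal of $P=\mathbb{Z}[x,y]/(p,x,y)^n$ such that $(p,x,y)^{n-1}\subseteq\mathfrak{b}\subseteq (p)+(x,y)^2$; (2) $\nu:\mathfrak{b}\to F_p$ is a homomorphism of abelian groups satisfying $\nu|_{\mathfrak{b}(p,x,y)}=0$; and (3) for any element $u$ of the ideal $(p)+(x,y)^2$ of $P$ such that $u(p,x,y)\subseteq\mathfrak{b}$, either $u\in\mathfrak{b}$ or at least one of $\nu(pu),\nu(xu),\nu(yu)$ is nonzero. *)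

(* Defs.v *)
From HB Require Import structures.
From mathcomp Require Import all_boot all_order all_algebra.
From mathcomp Require Import boolp classical_sets.
From mathcomp Require Import finmap monalg.

Set Implicit Arguments.
Unset Strict Implicit.
Unset Printing Implicit Defensive.

Import GRing.Theory.

Local Open Scope ring_scope.
Local Open Scope classical_set_scope.
Local Open Scope quotient_scope.

(* Rings are [pzRingType]s: the zero ring is a homomorphic image like any
   other. *)

Section Ideals.
Variable R : pzRingType.
Implicit Types (S T : set R) (a b r : R).

Definition is_ideal S : Prop :=
  [/\ S 0, forall a b, S a -> S b -> S (a - b)
    & forall a r, S a -> S (r * a) /\ S (a * r)].

Record ideal := Ideal { ideal_set :> R -> Prop; idealP : is_ideal ideal_set }.
Implicit Types I J : ideal.

Lemma idl0 J : J 0. Proof. by case: (idealP J). Qed.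

Lemma idlB J a b : J a -> J b -> J (a - b).
Proof. by case: (idealP J) => _ + _; apply. Qed.

Lemma idlN J a : J a -> J (- a).
Proof. by rewrite -sub0r; exact: idlB (idl0 J). Qed.

Lemma idlD J a b : J a -> J b -> J (a + b).
Proof. by move=> Ja Jb; rewrite -[b]opprK; exact/idlB/idlN. Qed.

Lemma idlMl J a r : J a -> J (r * a).
Proof. by case: (idealP J) => _ _ /[apply] /(_ r)[]. Qed.

Lemma idlMr J a r : J a -> J (a * r).
Proof. by case: (idealP J) => _ _ /[apply] /(_ r)[]. Qed.

Lemma ideal_gen_is_ideal S :
  is_ideal [set a | forall J : ideal, S `<=` J -> J a].
Proof.
split=> [J _|a b Sa Sb J SJ|a r Sa]; first exact: idl0.
  by apply: idlB; [apply: Sa|apply: Sb].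
by split=> J SJ; [apply: idlMl|apply: idlMr]; apply: Sa.
Qed.
Definition ideal_gen S : ideal := Ideal (ideal_gen_is_ideal S).

Lemma mem_ideal_gen S a : S a -> ideal_gen S a.
Proof. by move=> Sa J; apply. Qed.

Lemma ideal_gen_sub S J : S `<=` J -> ideal_gen S `<=` J.
Proof. by move=> SJ a; apply. Qed.

Lemma ideal_add_is_ideal I J : is_ideal [set a + b | a in I & b in J].
Proof.
split=> [|_ _ [a Ia [b Jb <-]] [c Ic [d Jd <-]]|_ r [a Ia [b Jb <-]]].
- by exists 0; [exact: idl0|exists 0; rewrite ?addr0//; exact: idl0].
- exists (a - c); first exact: idlB.
  by exists (b - d); [exact: idlB|rewrite opprD addrACA].
- split.
    exists (r * a); first exact: idlMl.
    by exists (r * b); [exact: idlMl|rewrite mulrDr].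
  exists (a * r); first exact: idlMr.
  by exists (b * r); [exact: idlMr|rewrite mulrDl].
Qed.
Definition ideal_add I J : ideal := Ideal (ideal_add_is_ideal I J).

(* For ideals S and T this is the usual product ST: the finite sums of
   products a * b already form an ideal. *)
Definition ideal_mul S T : ideal := ideal_gen [set a * b | a in S & b in T].

Definition ideal_exp I (n : nat) : ideal :=
  iter n (fun J : ideal => ideal_mul I J) (ideal_gen [set 1]).

Lemma ideal_mulM S T a b :
  S a -> T b -> ideal_mul S T (a * b).
Proof. by move=> Sa Tb; apply: mem_ideal_gen; exists a => //; exists b. Qed.

Lemma ideal_expSr (M : ideal) k a b :
  ideal_exp M k a -> M b -> ideal_exp M k.+1 (a * b).
Proof.
elim: k a b => [|k IHk] a b Ea Mb.
  rewrite -[X in _ _ X]mulr1; apply: ideal_mulM; first exact: idlMl.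
  exact: mem_ideal_gen.
pose T := [set c : R | forall d, M d -> ideal_exp M k.+2 (c * d)].
have T_ideal : is_ideal T.
  split=> [d _|c c' Tc Tc' d Md|c r Tc].
  - by rewrite mul0r; exact: idl0.
  - by rewrite mulrBl; apply: idlB; [exact: Tc|exact: Tc'].
  - split=> d Md; rewrite -mulrA; first exact/idlMl/Tc.
    exact/Tc/idlMl.
apply: (Ea (Ideal T_ideal)) => // _ [m Mm [c Ec <-]] d Md.
by rewrite -mulrA; apply: ideal_mulM => //; exact: IHk.
Qed.

Definition ideal_pred J : {pred R} := fun a => `[< J a >].

Lemma ideal_pred_zmod_closed J : zmod_closed (ideal_pred J).
Proof.
split=> [|a b]; first exact/asboolP/idl0.
by rewrite !unfold_in => /asboolP Ja /asboolP Jb; exact/asboolP/idlB.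
Qed.
HB.instance Definition _ J :=
  GRing.isZmodClosed.Build R (ideal_pred J) (ideal_pred_zmod_closed J).
Definition ideal_zmod J : zmodClosed R := ideal_pred J.

Definition bracket a b : R := a * b - b * a.

(* (p, x, y) *)
Definition ideal_pxy (p : nat) (x y : R) : ideal := ideal_gen [set p%:R; x; y].

(* (p) + (x, y)^2 *)
Definition ideal_p_xy2 (p : nat) (x y : R) : ideal :=
  ideal_add (ideal_gen [set p%:R]) (ideal_exp (ideal_gen [set x; y]) 2).

End Ideals.

(* The library's additive quotient [Quotient.quot], given its ring structure
   (the library only does so for commutative rings and proper ideals). *)
Section QuotientRing.
Variables (R : pzRingType) (J : ideal R).

Definition quotr : Type := Quotient.quot (ideal_zmod J).
HB.instance Definition _ := Choice.on quotr.
HB.instance Definition _ := GRing.Zmodule.on quotr.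

Definition quotr_pi (a : R) : quotr := \pi_(Quotient.quot (ideal_zmod J)) a.
Definition quotr_repr (u : quotr) : R := repr (u : Quotient.quot (ideal_zmod J)).

Lemma quotr_reprK : cancel quotr_repr quotr_pi.
Proof. by move=> u; exact: reprK. Qed.

Lemma quotr_piP a b : quotr_pi a = quotr_pi b <-> J (a - b).
Proof.
rewrite /quotr_pi; split=> [/eqP|Jab].
  by rewrite -Quotient.idealrBE => /asboolP.
by apply/eqP; rewrite -Quotient.idealrBE; exact/asboolP.
Qed.

Lemma quotr_pi_zmod : zmod_morphism quotr_pi.
Proof. exact: (raddfB (\pi_(Quotient.quot (ideal_zmod J)))). Qed.

Definition quotr_one : quotr := quotr_pi 1.
Definition quotr_mul (u v : quotr) : quotr :=
  quotr_pi (quotr_repr u * quotr_repr v).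

Lemma quotr_piM : {morph quotr_pi : a b / a * b >-> quotr_mul a b}.
Proof.
move=> a b; apply/quotr_piP.
have Ja : J (a - quotr_repr (quotr_pi a)).
  by apply/quotr_piP; rewrite quotr_reprK.
have Jb : J (b - quotr_repr (quotr_pi b)).
  by apply/quotr_piP; rewrite quotr_reprK.
set a' := quotr_repr _ in Ja *; set b' := quotr_repr _ in Jb *.
rewrite -[a * b](subrK (a' * b)) -mulrBl -addrA -mulrBr.
by apply: idlD; [apply: idlMr|apply: idlMl].
Qed.

Lemma quotr_mulA : associative quotr_mul.
Proof.
move=> u v w; rewrite -[u]quotr_reprK -[v]quotr_reprK -[w]quotr_reprK.
by rewrite -!quotr_piM mulrA.
Qed.

Lemma quotr_mul1r : left_id quotr_one quotr_mul.
Proof.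
by move=> u; rewrite -[u]quotr_reprK /quotr_one -quotr_piM mul1r.
Qed.

Lemma quotr_mulr1 : right_id quotr_one quotr_mul.
Proof.
by move=> u; rewrite -[u]quotr_reprK /quotr_one -quotr_piM mulr1.
Qed.

Lemma quotr_piD : {morph quotr_pi : a b / a + b}.
Proof. exact: (raddfD (\pi_(Quotient.quot (ideal_zmod J)))). Qed.

Lemma quotr_mulDl : left_distributive quotr_mul +%R.
Proof.
move=> u v w; rewrite -[u]quotr_reprK -[v]quotr_reprK -[w]quotr_reprK.
by rewrite -quotr_piD -!quotr_piM mulrDl quotr_piD.
Qed.

Lemma quotr_mulDr : right_distributive quotr_mul +%R.
Proof.
move=> u v w; rewrite -[u]quotr_reprK -[v]quotr_reprK -[w]quotr_reprK.
by rewrite -quotr_piD -!quotr_piM mulrDr quotr_piD.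
Qed.

HB.instance Definition _ := GRing.Zmodule_isPzRing.Build quotr
  quotr_mulA quotr_mul1r quotr_mulr1 quotr_mulDl quotr_mulDr.
HB.instance Definition _ :=
  GRing.isZmodMorphism.Build R quotr quotr_pi quotr_pi_zmod.
HB.instance Definition _ :=
  GRing.isMonoidMorphism.Build R quotr quotr_pi (conj erefl quotr_piM).

End QuotientRing.

Definition ring_isomorphic (R S : pzRingType) : Prop :=
  exists f : {rmorphism R -> S}, bijective f.

Definition minimal_noncommutative (R : pzRingType) : Prop :=
  [/\ ~ commutative ( *%R : R -> R -> R),
      forall S : {pred R}, subring_closed S -> (exists a, a \notin S) ->
        {in S &, commutative ( *%R : R -> R -> R)}
    & forall J : ideal R, (exists2 a, J a & a != 0) ->
        commutative ( *%R : quotr J -> quotr J -> quotr J)].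

(* Z<x,y> and Z[x,y], as the monoid rings over Z of the free monoid and of the
   free commutative monoid on two generators. *)
Definition freeZ : nzRingType := {malg int[{fmonom 'I_2}]}.
Definition polyZ : comNzRingType := {malg int[{cmonom 'I_2}]}.

Definition i0 : 'I_2 := ord0.
Definition i1 : 'I_2 := ord_max.

Definition xF : freeZ := << fmu i0 >>.
Definition yF : freeZ := << fmu i1 >>.
Definition xZ : polyZ := << ucm i0 >>.
Definition yZ : polyZ := << ucm i1 >>.

(* The additive map sending each monomial x^s y^t to r^s q^t, in this order. *)
Definition eval2 (S : pzRingType) (r q : S) (g : polyZ) : S :=
  \sum_(m <- msupp g) (r ^+ m i0 * q ^+ m i1) *~ g@_m.

Section Eval2.
Variables (S : pzRingType) (r q : S).

Lemma eval2_suppw (d : {fset {cmonom 'I_2}}) (g : polyZ) :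
    (msupp g `<=` d)%fset ->
  eval2 r q g = \sum_(m <- d) (r ^+ m i0 * q ^+ m i1) *~ g@_m.
Proof.
move=> le; rewrite [LHS](big_fset_incl _ le) => //= m _ /mcoeff_outdom ->.
by rewrite mulr0z.
Qed.

Lemma eval2_zmod : zmod_morphism (eval2 r q).
Proof.
move=> g h; pose d := (msupp g `|` msupp h)%fset.
rewrite !(@eval2_suppw d) ?fsubsetUl ?fsubsetUr ?msuppB_le//.
by rewrite -sumrB; apply: eq_bigr => m _; rewrite mcoeffB mulrzBr.
Qed.
HB.instance Definition _ :=
  GRing.isZmodMorphism.Build polyZ S (eval2 r q) eval2_zmod.

Lemma eval2U (c : int) (m : {cmonom 'I_2}) :
  eval2 r q << c *g m >> = (r ^+ m i0 * q ^+ m i1) *~ c.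
Proof. by rewrite (eval2_suppw msuppU_le) big_seq_fset1 mcoeffUU. Qed.

Lemma polyZ_mulUU (c d : int) (k l : {cmonom 'I_2}) :
  (<< c *g k >> : polyZ) * << d *g l >> = << c * d *g mmul k l >>.
Proof.
by rewrite (malgMEw msuppU_le msuppU_le) !big_seq_fset1 !mcoeffUU.
Qed.

Lemma eval2_mulU (c : int) (m : {cmonom 'I_2}) (g : polyZ) :
  eval2 r q (<< c *g m >> * g) = (r ^+ m i0 * eval2 r q g * q ^+ m i1) *~ c.
Proof.
rewrite [g in LHS]monalgE [g in RHS]monalgE mulr_sumr !raddf_sum /=.
rewrite mulr_sumr mulr_suml mulrz_suml; apply: eq_bigr => k _.
rewrite polyZ_mulUU [LHS]eval2U eval2U !cmM exprD [(m i1 + _)%N]addnC exprD.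
by rewrite mulrzAr mulrzAl -mulrzA [(_ * c)%R]mulrC !mulrA.
Qed.

Lemma eval2_mulX (g : polyZ) : eval2 r q (xZ * g) = r * eval2 r q g.
Proof. by rewrite eval2_mulU !cmU mulr1 mulr1z. Qed.

Lemma eval2_mulY (g : polyZ) : eval2 r q (yZ * g) = eval2 r q g * q.
Proof. by rewrite eval2_mulU !cmU mul1r mulr1z. Qed.

End Eval2.

Lemma eval2_rmorph (S S' : pzRingType) (h : {rmorphism S -> S'}) (r q : S) g :
  h (eval2 r q g) = eval2 (h r) (h q) g.
Proof.
rewrite raddf_sum; apply: eq_bigr => m _.
by rewrite raddfMz /= rmorphM /= !rmorphXn.
Qed.

Lemma preim_eval2_is_ideal (S : pzRingType) (r q : S) (J : ideal S) :
  is_ideal [set g | J (eval2 r q g)].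
Proof.
have mulJ (h g : polyZ) : J (eval2 r q g) -> J (eval2 r q (h * g)).
  move=> Jg; rewrite [h]monalgE mulr_suml raddf_sum /=.
  apply: big_ind => [|a b|m _]; [exact: idl0|exact: idlD|].
  rewrite eval2_mulU -mulrzl; apply: idlMl; apply: idlMr; exact: idlMl.
split=> [|g h Jg Jh|g h Jg] /=.
- by rewrite raddf0; exact: idl0.
- by rewrite raddfB; exact: idlB.
- by split; [|rewrite mulrC]; exact: mulJ.
Qed.

Lemma eval2_exp (p k : nat) (g : polyZ) :
  ideal_exp (ideal_pxy p xZ yZ) k g ->
  ideal_exp (ideal_pxy p xF yF) k (eval2 xF yF g).
Proof.
set M := ideal_pxy p xZ yZ; set N := ideal_pxy p xF yF.
elim: k g => [|k IHk] g Eg.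
  by rewrite -[eval2 _ _ _]mulr1; apply/idlMl/mem_ideal_gen.
have [pN xN yN] : [/\ N p%:R, N xF & N yF].
  by split; apply: mem_ideal_gen; [left; left|left; right|right].
apply: (Eg (Ideal (preim_eval2_is_ideal xF yF (ideal_exp N k.+1)))) => /=.
move=> _ [a Ma [b Eb <-]] /=.
pose T := [set a : polyZ | forall b, ideal_exp M k b ->
  ideal_exp N k.+1 (eval2 xF yF (a * b))].
have T_ideal : is_ideal T.
  split=> [c _|c c' Tc Tc' d Ed|c r Tc].
  - by rewrite mul0r raddf0; exact: idl0.
  - by rewrite mulrBl raddfB; apply: idlB; [exact: Tc|exact: Tc'].
  - split=> d Ed; last by rewrite -mulrA; exact/Tc/idlMl.
    by rewrite [r * c]mulrC -mulrA; exact/Tc/idlMl.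
apply: (Ma (Ideal T_ideal)) => // {a b Ma Eb} _ [[->|->]|->] b Eb.
- rewrite mulr_natl raddfMn -mulr_natl; apply: ideal_mulM => //.
  exact: IHk.
- rewrite eval2_mulX; apply: ideal_mulM => //; exact: IHk.
- rewrite eval2_mulY; apply: ideal_expSr => //; exact: IHk.
Qed.

Section Pairs.
Variables p n : nat.

(* Both sets of products generate, additively, a two-sided ideal, since
   (p, x, y) is one. *)
Definition idealI : ideal freeZ :=
  ideal_add
    (ideal_gen [set a * bracket xF yF * b | a in ideal_pxy p xF yF & b in setT])
    (ideal_gen [set b * bracket xF yF * a | b in setT & a in ideal_pxy p xF yF]).

Definition ringA : pzRingType :=
  quotr (ideal_add idealI (ideal_exp (ideal_pxy p xF yF) n)).
Definition xA : ringA := quotr_pi _ xF.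
Definition yA : ringA := quotr_pi _ yF.

Definition ringP : pzRingType := quotr (ideal_exp (ideal_pxy p xZ yZ) n).
Definition xP : ringP := quotr_pi _ xZ.
Definition yP : ringP := quotr_pi _ yZ.

(* Independent of the representative: see [iotaPA_pi]. *)
Definition iotaPA (u : ringP) : ringA := eval2 xA yA (quotr_repr u).

Lemma iotaPA_pi (g : polyZ) :
  iotaPA (quotr_pi _ g : ringP) = eval2 xA yA g.
Proof.
have evA h : eval2 xA yA h = quotr_pi _ (eval2 xF yF h).
  by rewrite eval2_rmorph.
rewrite /iotaPA !evA; apply/quotr_piP; rewrite -raddfB.
exists 0; first exact: idl0.
exists (eval2 xF yF (quotr_repr (quotr_pi _ g : ringP) - g)).
  by apply/eval2_exp/quotr_piP; rewrite quotr_reprK.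
by rewrite add0r.
Qed.

Section AssociatedPair.
Variables (R : pzRingType) (f : {rmorphism ringA -> R}).

Definition bracketR : R := bracket (f xA) (f yA).
Definition ringC : pzRingType := quotr (ideal_gen [set bracketR]).

(* The map ringP -> ringC sending x to x and y to y. *)
Definition toC (u : ringP) : ringC :=
  eval2 (quotr_pi _ (f xA)) (quotr_pi _ (f yA)) (quotr_repr u).

Lemma toCE (u : ringP) : toC u = quotr_pi _ (f (iotaPA u)).
Proof. by rewrite /iotaPA !eval2_rmorph. Qed.

Definition assoc_ideal : set ringP := [set u | toC u = 0].

(* Only the values on [assoc_ideal] are meaningful. *)
Definition assoc_map (u : ringP) : 'F_p :=
  if bracketR == 0 then 0
  else odflt 0 [pick m : 'F_p | f (iotaPA u) == bracketR *+ m].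

End AssociatedPair.

(* Only the restriction of nu to b is constrained: a map from b to F_p is
   represented by a total function on ringP. *)
Definition minimal_generating (b : set ringP) (nu : ringP -> 'F_p) : Prop :=
  let M := ideal_pxy p xP yP in
  let N := ideal_p_xy2 p xP yP in
  [/\ [/\ is_ideal b, ideal_exp M n.-1 `<=` b & b `<=` N],
      (forall u v, b u -> b v -> nu (u + v) = nu u + nu v) /\
        (forall u, ideal_mul b M u -> nu u = 0)
    & forall u, N u -> (forall v, M v -> b (u * v)) ->
        b u \/ [\/ nu (p%:R * u) != 0, nu (xP * u) != 0 | nu (yP * u) != 0]].

End Pairs.

(* Main.v *)
(* In R put c = [x, y] and m = (p, x, y); then m c = c m = 0, m^n = 0, every
   commutator is a multiple of c, and the elements of (p) + (x, y)^2 are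
   central.  Two elements of a subring with nonzero commutator are, modulo
   constants, an invertible combination of x and y modulo m^2, so by Nakayama
   the subring is all of R.  Hence R is minimal noncommutative iff c <> 0 and
   every nonzero ideal contains c, i.e. iff c <> 0 and every central element
   annihilated by m is a multiple of c.  Writing an element of R as the image of
   some u in P plus a multiple of c turns this into condition (3).  Finally, if
   c = 0 then condition (3) lets one descend from m^(n-1) to m^2 and then to
   (p) + (x, y)^2, so that R would be the excluded quotient of Z[x, y]. *)
Require Import Defs.
From HB Require Import structures.
From mathcomp Require Import all_boot all_order all_algebra.
From mathcomp Require Import boolp classical_sets.
From mathcomp Require Import finmap monalg.

Set Implicit Arguments.
Unset Strict Implicit.
Unset Printing Implicit Defensive.

Import GRing.Theory.

Local Open Scope ring_scope.
Local Open Scope classical_set_scope.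


(** * Ideals, their powers, and the ideals [(p, x, y)] and [(p) + (x, y)^2] *)

Section IdealTheory.
Variable S : pzRingType.
Implicit Types (I J K : ideal S) (a b : S).

Lemma ideal_gen_ind (G T : set S) :
  is_ideal T -> G `<=` T -> ideal_gen G `<=` T.
Proof. by move=> T_ideal GT a /(_ (Ideal T_ideal)); apply. Qed.

Lemma idlMz J a (k : int) : J a -> J (a *~ k).
Proof. by move=> Ja; rewrite -mulrzr; apply: idlMr. Qed.

Lemma idl_subr J a b : J b -> J (a - b) -> J a.
Proof. by move=> Jb Jab; rewrite -(subrK b a); apply: idlD. Qed.

Lemma ideal_exp0 I a : ideal_exp I 0 a.
Proof. by rewrite -[a]mulr1; apply/idlMl/mem_ideal_gen. Qed.

Lemma ideal_exp_sub1 I k a : ideal_exp I k.+1 a -> I a.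
Proof.
apply: ideal_gen_sub a.
by move=> _ [a Ia [b _ <-]]; apply: idlMr.
Qed.

Lemma ideal_exp1 I a : I a -> ideal_exp I 1 a.
Proof.
by move=> Ia; rewrite -[a]mulr1; apply: ideal_mulM => //; apply: ideal_exp0.
Qed.

Lemma ideal_expS I k a : ideal_exp I k.+1 a -> ideal_exp I k a.
Proof.
apply: ideal_gen_sub a.
by move=> _ [a _ [b Eb <-]]; apply: idlMl.
Qed.

Lemma ideal_exp_le I k l a : (k <= l)%N -> ideal_exp I l a -> ideal_exp I k a.
Proof.
move=> /subnKC <-; elim: (l - k)%N => [|d IHd]; first by rewrite addn0.
by rewrite addnS => /ideal_expS /IHd.
Qed.

Lemma ideal_expD I k l a b :
  ideal_exp I k a -> ideal_exp I l b -> ideal_exp I (k + l) (a * b).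
Proof.
move=> Ea Eb; elim: k a Ea => [|k IHk] a; first by move=> _; apply: idlMl.
(* The free factor [d] makes [T] stable under right multiplication; [d = 1] gives the claim. *)
pose T : set S := [set c | forall d, ideal_exp I (k.+1 + l) (c * (d * b))].
move=> Ea; suff /(_ _ Ea 1) : ideal_exp I k.+1 `<=` T by rewrite mul1r.
apply: ideal_gen_ind => [|_ [c Ic [d Ed <-]] e].
  split=> [d|c c' Tc Tc' d|c r Tc].
  - by rewrite mul0r; apply: idl0.
  - by rewrite mulrBl; apply: idlB.
  - split=> d; first by rewrite -mulrA; apply: idlMl.
    by rewrite -mulrA (mulrA r).
rewrite -mulrA; apply: ideal_mulM => //.
by rewrite mulrA; apply: IHk; apply: idlMr.
Qed.

Lemma ideal_addl I J a : I a -> ideal_add I J a.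
Proof. by move=> Ia; exists a => //; exists 0; [apply: idl0|rewrite addr0]. Qed.

Lemma ideal_addr I J a : J a -> ideal_add I J a.
Proof. by move=> Ja; exists 0; [apply: idl0|exists a; rewrite ?add0r]. Qed.

Lemma ideal_add_sub I J K : I `<=` K -> J `<=` K -> ideal_add I J `<=` K.
Proof. by move=> IK JK _ [a /IK Ka [b /JK Kb <-]]; apply: idlD. Qed.

Lemma zero_is_ideal : is_ideal [set (0 : S)].
Proof.
split=> // [a b -> ->|a r ->]; first exact: subrr.
by split; [apply: mulr0|apply: mul0r].
Qed.

Section Generators.
Variables (p : nat) (x y : S).
Local Notation M := (ideal_pxy p x y).
Local Notation N := (ideal_p_xy2 p x y).

Lemma pxy_p : M p%:R. Proof. by apply: mem_ideal_gen; left; left. Qed.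
Lemma pxy_x : M x. Proof. by apply: mem_ideal_gen; left; right. Qed.
Lemma pxy_y : M y. Proof. by apply: mem_ideal_gen; right. Qed.

Lemma pxy_sub J : J p%:R -> J x -> J y -> M `<=` J.
Proof. by move=> Jp Jx Jy; apply: ideal_gen_sub => _ [[->|->]|->]. Qed.

Lemma xy_x : ideal_gen [set x; y] x. Proof. by apply: mem_ideal_gen; left. Qed.
Lemma xy_y : ideal_gen [set x; y] y. Proof. by apply: mem_ideal_gen; right. Qed.

Lemma xy_sub J : J x -> J y -> ideal_gen [set x; y] `<=` J.
Proof. by move=> Jx Jy; apply: ideal_gen_sub => _ [->|->]. Qed.

Lemma p_xy2_p : N p%:R.
Proof. exact/ideal_addl/mem_ideal_gen. Qed.

Lemma p_xy2_M a b :
  ideal_gen [set x; y] a -> ideal_gen [set x; y] b -> N (a * b).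
Proof.
by move=> Ga Gb; apply: ideal_addr; apply: ideal_mulM => //; apply: ideal_exp1.
Qed.

Lemma p_xy2_sub J : J p%:R ->
    (forall a b, ideal_gen [set x; y] a -> ideal_gen [set x; y] b -> J (a * b)) ->
  N `<=` J.
Proof.
move=> Jp Jxy; apply: ideal_add_sub; first by apply: ideal_gen_sub => _ ->.
apply: ideal_gen_sub => _ [a Ga [b /(@ideal_exp_sub1 _ 0) Gb <-]]; exact: Jxy.
Qed.

Lemma p_xy2_sub_pxy : N `<=` M.
Proof.
apply: p_xy2_sub => [|a b Ga _]; first exact: pxy_p.
by apply: idlMr; move: Ga; apply: xy_sub; [apply: pxy_x|apply: pxy_y].
Qed.

(** Split each factor into a part in [(p)] and a part in [(x, y)]: only the product of the two
    [(x, y)] parts falls outside [(p)], and it lies in [(x, y)^2]. *)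
Lemma pxy_mul_sub a b : M a -> M b -> N (a * b).
Proof.
have sub : M `<=` ideal_add (ideal_gen [set p%:R]) (ideal_gen [set x; y]).
  apply: pxy_sub; first exact/ideal_addl/mem_ideal_gen.
    exact/ideal_addr/xy_x.
  exact/ideal_addr/xy_y.
have pN : ideal_gen [set p%:R] `<=` N.
  by apply: ideal_gen_sub => _ ->; apply: p_xy2_p.
move=> /sub [a1 /pN Na1 [a2 Ga2 <-]] /sub [b1 /pN Nb1 [b2 Gb2 <-]].
rewrite mulrDl [a2 * _]mulrDr; apply: idlD; first exact: idlMr.
by apply: idlD; [apply: idlMl|apply: p_xy2_M].
Qed.

Lemma pxy_exp2_sub a : ideal_exp M 2 a -> N a.
Proof.
apply: ideal_gen_sub a => _ [a Ma [b /(@ideal_exp_sub1 _ 0) Mb <-]].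
exact: pxy_mul_sub.
Qed.

End Generators.
End IdealTheory.

(** * Ideals along ring morphisms *)

Section IdealMorphism.
Variables (S S' : pzRingType) (h : {rmorphism S -> S'}).

Lemma preim_is_ideal (J : ideal S') : is_ideal [set a | J (h a)].
Proof.
split=> [|a b Ja Jb|a r Ja] /=.
- by rewrite rmorph0; apply: idl0.
- by rewrite rmorphB; apply: idlB.
- by rewrite !rmorphM; split; [apply: idlMl|apply: idlMr].
Qed.
Definition preim_ideal J : ideal S := Ideal (preim_is_ideal J).

Hypothesis h_surj : forall b, exists a, h a = b.

Lemma image_is_ideal (J : ideal S) : is_ideal [set h a | a in J].
Proof.
split=> [|_ _ [a Ja <-] [b Jb <-]|_ r [a Ja <-]].
- by exists 0; [apply: idl0|rewrite rmorph0].
- by exists (a - b); [apply: idlB|rewrite rmorphB].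
- have [s <-] := h_surj r; split.
    by exists (s * a); [apply: idlMl|rewrite rmorphM].
  by exists (a * s); [apply: idlMr|rewrite rmorphM].
Qed.
Definition image_ideal J : ideal S' := Ideal (image_is_ideal J).

(** Products are lifted factor by factor; this is how nilpotency of [(p, x, y)] passes to images. *)
Lemma image_ideal_exp (I : ideal S) (I' : ideal S') k :
  I' `<=` image_ideal I -> ideal_exp I' k `<=` image_ideal (ideal_exp I k).
Proof.
move=> II'; elim: k => [|k IHk] b.
  by move=> _; have [a <-] := h_surj b; exists a => //; apply: ideal_exp0.
apply: ideal_gen_sub => _ [_ /II' [c Ic <-] [_ /IHk [d Ed <-] <-]].
by exists (c * d); [apply: ideal_mulM|rewrite rmorphM].
Qed.

Lemma image_pxy_exp p x y k :
  ideal_exp (ideal_pxy p (h x) (h y)) k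
    `<=` image_ideal (ideal_exp (ideal_pxy p x y) k).
Proof.
apply: image_ideal_exp; apply: pxy_sub.
- by exists p%:R; [apply: pxy_p|rewrite rmorph_nat].
- by exists x => //; apply: pxy_x.
- by exists y => //; apply: pxy_y.
Qed.

Lemma image_p_xy2 p x y :
  ideal_p_xy2 p (h x) (h y) `<=` image_ideal (ideal_p_xy2 p x y).
Proof.
have sub : ideal_gen [set h x; h y] `<=` image_ideal (ideal_gen [set x; y]).
  by apply: xy_sub; [exists x => //; apply: xy_x|exists y => //; apply: xy_y].
apply: p_xy2_sub => [|_ _ /sub [a Ga <-] /sub [b Gb <-]].
  by exists p%:R; [apply: p_xy2_p|rewrite rmorph_nat].
by exists (a * b); [apply: p_xy2_M|rewrite rmorphM].
Qed.

End IdealMorphism.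

(** * Subrings and generation by two elements *)

Section Generation.

Definition subringP (S : pzRingType) (T : set S) : Prop :=
  [/\ T 1, forall a b, T a -> T b -> T (a - b)
    & forall a b, T a -> T b -> T (a * b)].

(** Serves as an induction principle: [T] is instantiated with the property to be proved of all
    elements. *)
Definition generated_by (S : pzRingType) (x y : S) : Prop :=
  forall T : set S, subringP T -> T x -> T y -> forall a, T a.

Lemma subringP0 (S : pzRingType) (T : set S) : subringP T -> T 0.
Proof. by case=> T1 TB _; rewrite -(subrr 1); apply: TB. Qed.

Lemma subringPD (S : pzRingType) (T : set S) a b :
  subringP T -> T a -> T b -> T (a + b).
Proof.
move=> ringT Ta Tb; have T0 := subringP0 ringT; have [_ TB _] := ringT.
by rewrite -[b]opprK -[- b]sub0r; apply: (TB) => //; apply: TB.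
Qed.

Lemma subringPz (S : pzRingType) (T : set S) a (k : int) :
  subringP T -> T a -> T (a *~ k).
Proof.
move=> ringT Ta; have Tn m : T (a *+ m).
  elim: m => [|m IHm]; first exact: subringP0.
  by rewrite mulrS; apply: subringPD.
case: k => m; first exact: Tn.
rewrite NegzE mulrNz -sub0r; have [_ TB _] := ringT.
by apply: TB; [apply: subringP0|apply: Tn].
Qed.

Lemma generated_by_surj (S S' : pzRingType) (h : {rmorphism S -> S'}) (x y : S) :
  (forall b, exists a, h a = b) -> generated_by x y ->
  generated_by (h x) (h y).
Proof.
move=> h_surj gen T [T1 TB TM] Tx Ty b; have [a <-] := h_surj b.
apply: (gen (h @^-1` T)) => //; split=> [|a' b' Ta Tb|a' b' Ta Tb] /=.
- by rewrite /preimage /= rmorph1.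
- by rewrite /preimage /= rmorphB; apply: TB.
- by rewrite /preimage /= rmorphM; apply: TM.
Qed.

Lemma mkmalgU_intE (K : monomType) (c : int) (m : K) :
  << c *g m >> = (<< m >> : {malg int[K]}) *~ c.
Proof. by rewrite -[in LHS](intz c) raddfMz. Qed.

Lemma mkmalgUM (K : monomType) (k l : K) :
  (<< mmul k l >> : {malg int[K]}) = << k >> * << l >>.
Proof.
by rewrite (malgMEw msuppU_le msuppU_le) !big_seq_fset1 !mcoeffUU mulr1.
Qed.

(** Reduces generation of a monoid ring to generation of its monoid, since every element is an
    integer combination of monomials. *)
Lemma subringP_malg (K : monomType) (T : set {malg int[K]}) (U : set K) :
    subringP T -> (forall m, T << m >> <-> U m) ->
  [/\ U mone, forall k l, U k -> U l -> U (mmul k l)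
    & (forall m, U m) -> forall g, T g].
Proof.
move=> ringT TU; split.
- by apply/TU; have [T1 _ _] := ringT.
- move=> k l /TU Tk /TU Tl; apply/TU; rewrite mkmalgUM.
  by have [_ _ TM] := ringT; apply: TM.
move=> Um g; rewrite [g]monalgE.
apply: big_ind => [|a b|m _]; [exact: subringP0|exact: subringPD|].
by rewrite mkmalgU_intE; apply: subringPz => //; apply/TU.
Qed.

Lemma ord2P (i : 'I_2) : i = i0 \/ i = i1.
Proof. by case: i => [[|[|//]] lti]; [left|right]; apply: val_inj. Qed.

Lemma generated_freeZ : generated_by xF yF.
Proof.
move=> T ringT Tx Ty.
pose U : set {fmonom 'I_2} := [set m | T << m >>].
have [U1 UM] := @subringP_malg _ T U ringT (fun=> conj id id).
apply; have Ux : U (fmu i0) := Tx; have Uy : U (fmu i1) := Ty.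
move: U U1 UM Ux Uy => {T ringT Tx Ty} U U1 UM Ux Uy [s].
have Uu i : U (fmu i) by case: (ord2P i) => ->.
elim: s => [|i s IHs].
  have -> // : FMonom [::] = mone :> {fmonom 'I_2}.
  by apply/val_inj; rewrite /= fm1.
have -> : FMonom (i :: s) = mmul (fmu i) (FMonom s).
  by apply/val_inj; rewrite /= fmM fmU.
exact: UM.
Qed.

Lemma generated_polyZ : generated_by xZ yZ.
Proof.
move=> T ringT Tx Ty.
pose U : set {cmonom 'I_2} := [set m | T << m >>].
have [U1 UM] := @subringP_malg _ T U ringT (fun=> conj id id).
apply; have Ux : U (ucm i0) := Tx; have Uy : U (ucm i1) := Ty.
move: U U1 UM Ux Uy => {T ringT Tx Ty} U U1 UM Ux Uy m.
have Uu i : U (ucm i) by case: (ord2P i) => ->.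
(* Induction on the total degree: a generator with positive exponent is divided out. *)
have [k] := ubnP (m i0 + m i1)%N; elim: k m => // k IHk m; rewrite ltnS => mk.
have step i : (0 < m i)%N -> U m.
  move=> mi_gt0; have mE : m = mmul (ucm i) (divcm m (ucm i)).
    apply/eqP/cmP => j; rewrite cmM divcmE subnKC // ucmE.
    by have [<-|] := eqVneq i j.
  rewrite mE; apply: UM => //.
  apply: IHk; apply: leq_trans mk.
  rewrite [in leqRHS]mE !cmM.
  by case: (ord2P i) => ->; rewrite !ucmE //= ?addn0 ?add0n ?add1n ?addnS.
have [m0|] := posnP (m i0); last exact: step.
have [m1|] := posnP (m i1); last exact: step.
have -> : m = mone; last by [].
by apply/eqP/cmP => j; rewrite cm1; case: (ord2P j) => ->.
Qed.

End Generation.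
Lemma subrACA (V : zmodType) (a b c d : V) : a - b - (c - d) = a - c - (b - d).
Proof. by rewrite !opprD addrACA. Qed.

(** * Residues modulo [(p, x, y)] and modulo [(p) + (x, y)^2] *)

Section TwoGenerators.
Variables (S : pzRingType) (x y : S).
Hypothesis gen : generated_by x y.

(** The centraliser of [a] is a subring. *)
Lemma generated_central a : a * x = x * a -> a * y = y * a ->
  forall r, a * r = r * a.
Proof.
move=> ax ay; apply: gen => //; split=> [|b c ab ac|b c ab ac] /=.
- by rewrite mulr1 mul1r.
- by rewrite mulrBr mulrBl ab ac.
- by rewrite mulrA ab -mulrA ac mulrA.
Qed.

(** Apply the centraliser argument first to [x] and [y], then to an arbitrary element. *)
Lemma generated_comm : x * y = y * x -> commutative ( *%R : S -> S -> S).
Proof.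
move=> xy a; apply: generated_central; first exact/esym/generated_central.
exact/esym/generated_central.
Qed.

Variable p : nat.
Local Notation M := (ideal_pxy p x y).
Local Notation N := (ideal_p_xy2 p x y).

(** Both generators vanish modulo [M], so [S / M] is an image of the integers. *)
Lemma pxy_coset r : exists i : int, M (r - i%:~R).
Proof.
apply: (gen (T := [set r | exists i : int, M (r - i%:~R)])).
- split=> [|a b [i Mi] [j Mj]|a b [i Mi] [j Mj]].
  + by exists 1; rewrite mulr1z subrr; apply: idl0.
  + by exists (i - j); rewrite rmorphB subrACA; apply: idlB.
  + exists (i * j); rewrite rmorphM.
    have -> : a * b - i%:~R * j%:~R = a * (b - j%:~R) + (a - i%:~R) * j%:~R.
      by rewrite mulrBr mulrBl addrA subrK.
    by apply: idlD; [apply: idlMl|apply: idlMr].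
- by exists 0; rewrite subr0; apply: pxy_x.
- by exists 0; rewrite subr0; apply: pxy_y.
Qed.

(** As [M * M] lies in [N], the ring acts on [M / N] through integers; hence [M / N] is spanned
    additively by [x] and [y], the third generator [p] being zero there. *)
Lemma pxy_coset2 a : M a -> exists i j : int, N (a - (x *~ i + y *~ j)).
Proof.
pose T := [set a | exists i j : int, N (a - (x *~ i + y *~ j))].
have MT b : T b -> M b.
  case=> i [j /p_xy2_sub_pxy]; apply: idl_subr.
  by apply: idlD; apply: idlMz; [apply: pxy_x|apply: pxy_y].
have T_ideal : is_ideal T.
  split=> [|b c [i [j Nb]] [k [l Nc]]|b r Tb].
  - by exists 0, 0; rewrite !mulr0z addr0 subrr; apply: idl0.
  - exists (i - k), (j - l); rewrite !mulrzBr addrACA -opprD subrACA.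
    exact: idlB.
  - have [k Mr] := pxy_coset r; have Mb := MT b Tb.
    case: Tb => i [j Nb]; have Nbk := idlMz k Nb.
    rewrite mulrzBl mulrzDl -!mulrzA in Nbk.
    split; exists (i * k), (j * k).
      apply: (idl_subr (b := b *~ k - (x *~ (i * k) + y *~ (j * k)))) => //.
      rewrite opprB addrA subrK -mulrzl -mulrBl; exact: pxy_mul_sub.
    apply: (idl_subr (b := b *~ k - (x *~ (i * k) + y *~ (j * k)))) => //.
    rewrite opprB addrA subrK -mulrzr -mulrBr; exact: pxy_mul_sub.
apply: (ideal_gen_ind T_ideal) => _ [[->|->]|->].
- by exists 0, 0; rewrite !mulr0z addr0 subr0; apply: p_xy2_p.
- by exists 1, 0; rewrite mulr0z addr0 subrr; apply: idl0.
- by exists 0, 1; rewrite mulr0z add0r subrr; apply: idl0.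
Qed.

Lemma decomposition r :
  exists i j k : int, exists2 v, N v & r = i%:~R + (x *~ j + y *~ k) + v.
Proof.
have [i /pxy_coset2 [j [k Nv]]] := pxy_coset r.
exists i, j, k; eexists; first exact: Nv.
by rewrite [_ + _ + (_ - _)]addrAC -!addrA [- (_ + _) + _]addrC
  subrr addr0 addrC subrK.
Qed.

End TwoGenerators.

(** * Commutativity of quotients *)

Section QuotientGeneration.
Variables (S : pzRingType) (J : ideal S).

Lemma quotr_pi_surj (u : quotr J) : exists a, quotr_pi J a = u.
Proof. by exists (quotr_repr u); apply: quotr_reprK. Qed.

Lemma quotr_pi0 a : quotr_pi J a = 0 <-> J a.
Proof. by rewrite -[X in _ = X](rmorph0 (quotr_pi J)) quotr_piP subr0. Qed.

Lemma quotr_comm (x y : S) : generated_by x y ->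
  commutative ( *%R : quotr J -> quotr J -> quotr J) <-> J (bracket x y).
Proof.
move=> gen; split=> [comm|Jc].
  by apply/quotr_pi0; rewrite /bracket rmorphB !rmorphM /= comm subrr.
apply: (generated_comm (generated_by_surj quotr_pi_surj gen)).
by rewrite -!rmorphM; apply/quotr_piP.
Qed.

End QuotientGeneration.

Lemma int_bezout (p : nat) (k : int) : prime p -> ~~ (p %| k)%Z ->
  exists uv : int * int, uv.1 * p%:Z + uv.2 * k = 1.
Proof.
move=> p_prime pk; apply/coprimezP.
by rewrite coprimezE /= prime_coprime // -dvdzE.
Qed.

(** * Consequences of nilpotency: Nakayama's lemma and the socle *)

Section Nilpotent.
Variables (S : pzRingType) (x y : S) (p n : nat).
Hypothesis gen : generated_by x y.
Local Notation M := (ideal_pxy p x y).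
Local Notation N := (ideal_p_xy2 p x y).
Hypothesis M_nil : forall a, ideal_exp M n a -> a = 0.

(* Nakayama: a subring is everything as soon as it contains lifts of x and y
   modulo the square of the nilpotent ideal M. *)
Lemma subring_full (T : set S) (u v : S) : subringP T -> T u -> T v ->
  ideal_exp M 2 (x - u) -> ideal_exp M 2 (y - v) -> forall r, T r.
Proof.
move=> ringT Tu Tv xu yv; have [T1 TB TM] := ringT.
(* [E k] consists of the elements of [M^k] that agree with an element of [T] in [M^k] modulo
   [M^(k+1)]; the aim is [E k = M^k]. *)
pose E k : set S :=
  [set a | exists s, [/\ T s, ideal_exp M k s & ideal_exp M k.+1 (a - s)]].
have TZ (i : int) : T i%:~R by apply: subringPz.
have sub k a s : ideal_exp M k s -> ideal_exp M k.+1 (a - s) -> ideal_exp M k a.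
  by move=> Ms /ideal_expS; apply: idl_subr.
have E_ideal k : is_ideal (E k).
  split=> [|a b [s [Ts Ms Mas]] [t [Tt Mt Mbt]]|a r [s [Ts Ms Mas]]].
  - by exists 0; split; [apply: subringP0|apply: idl0|rewrite subrr; apply: idl0].
  - by exists (s - t); split; [apply: TB|apply: idlB|rewrite subrACA; apply: idlB].
  (* Modulo [M^(k+1)], [r] acts on [M^k] as the integer [i], so [s *~ i] approximates both [r * a]
     and [a * r]. *)
  have [i Mr] := pxy_coset gen p r.
  split; exists (s *~ i); split; [exact: subringPz|exact: idlMz| |
                                 exact: subringPz|exact: idlMz|].
    have -> : r * a - s *~ i = (r - i%:~R) * a + (a - s) *~ i.
      by rewrite mulrBl mulrzBl mulrzl addrA subrK.
    apply: idlD; last exact: idlMz.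
    by apply: ideal_mulM => //; apply: sub Mas.
  have -> : a * r - s *~ i = a * (r - i%:~R) + (a - s) *~ i.
    by rewrite mulrBr mulrzBl mulrzr addrA subrK.
  apply: idlD; last exact: idlMz.
  by apply: ideal_expSr => //; apply: sub Mas.
have E1 : M `<=` E 1%N.
  apply: (ideal_gen_ind (E_ideal 1%N)) => _ [[->|->]|->].
  - exists p%:R; split; [exact: (TZ p)|exact/ideal_exp1/pxy_p|].
    by rewrite subrr; apply: idl0.
  - exists u; split=> //; apply: (sub _ _ x); first exact/ideal_exp1/pxy_x.
    by rewrite -opprB; apply: idlN.
  - exists v; split=> //; apply: (sub _ _ y); first exact/ideal_exp1/pxy_y.
    by rewrite -opprB; apply: idlN.
have lift k : ideal_exp M k `<=` E k.
  elim: k => [|k IHk] r.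
    have [i Mr] := pxy_coset gen p r => _.
    by exists i%:~R; split; [apply: TZ|apply: ideal_exp0|apply: ideal_exp1].
  move: r; apply: (ideal_gen_ind (E_ideal k.+1)).
  move=> _ [a Ma [b Mb <-]]; have [s [Ts Ms Mas]] := E1 _ Ma.
  have [t [Tt Mt Mbt]] := IHk _ Mb; exists (s * t); split; first exact: TM.
    exact: (ideal_expD (k := 1) (l := k)).
  have -> : a * b - s * t = (a - s) * b + s * (b - t).
    by rewrite mulrBl mulrBr addrA subrK.
  apply: idlD; first exact: (ideal_expD (k := 2) (l := k)).
  exact: (ideal_expD (k := 1) (l := k.+1)).
(* Descend from [M^n = 0] to [M^0], the whole ring. *)
have full d k : (k + d)%N = n -> ideal_exp M k `<=` T.
  elim: d k => [|d IHd] k.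
    by rewrite addn0 => -> a /M_nil ->; apply: subringP0.
  rewrite addnS -addSn => /IHd MT a /lift [s [Ts _ /MT Tas]].
  by rewrite -(subrK s a); apply: subringPD.
by move=> r; apply: (full n 0%N) => //; apply: ideal_exp0.
Qed.

(** Otherwise [r] could be multiplied on the left by elements of ever higher powers of [M] without
    becoming zero. *)
Lemma ideal_socle (J : ideal S) r : J r -> r != 0 ->
  exists s, [/\ J s, s != 0, p%:R * s = 0, x * s = 0 & y * s = 0].
Proof.
move=> Jr r0; apply: contrapT => no_s.
suff alive k : exists2 w, ideal_exp M k w & w * r != 0.
  by have [w /M_nil ->] := alive n; rewrite mul0r eqxx.
elim: k => [|k [w Mw wr]].
  by exists 1; rewrite ?mul1r //; apply: ideal_exp0.
apply: contrapT => no_w; apply: no_s; exists (w * r).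
have kill m : M m -> m * (w * r) = 0.
  move=> Mm; apply/eqP; apply: contrapT => /negP mwr; apply: no_w.
  by exists (m * w); [apply: ideal_mulM|rewrite -mulrA].
split=> //; first exact: idlMl.
- exact/kill/pxy_p.
- exact/kill/pxy_x.
- exact/kill/pxy_y.
Qed.

(** Modulo [M^2] the ring acts on [p] through integers, so the ideal [(p)] contributes only integer
    multiples of [p]. *)
Lemma p_xy2_coset a : N a -> exists l : int, ideal_exp M 2 (a - p%:R *~ l).
Proof.
pose T : set S := [set a | exists l : int, ideal_exp M 2 (a - p%:R *~ l)].
have MM u v : M u -> M v -> ideal_exp M 2 (u * v).
  by move=> Mu Mv; apply: (ideal_mulM Mu); apply: ideal_exp1.
have T_ideal : is_ideal T.
  split=> [|u v [k Mu] [l Mv]|u r [k Mu]].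
  - by exists 0; rewrite mulr0z subrr; apply: idl0.
  - by exists (k - l); rewrite mulrzBr subrACA; apply: idlB.
  - have [i Mr] := pxy_coset gen p r.
    have Mp : M (p%:R *~ k) by apply/idlMz/pxy_p.
    split; exists (k * i).
      have -> : r * u - p%:R *~ (k * i)
              = r * (u - p%:R *~ k) + (r - i%:~R) * (p%:R *~ k).
        by rewrite mulrBr mulrBl addrA subrK mulrzl mulrzA.
      by apply: idlD; [apply: idlMl|apply: MM].
    have -> : u * r - p%:R *~ (k * i)
            = (u - p%:R *~ k) * r + (p%:R *~ k) * (r - i%:~R).
      by rewrite mulrBl mulrBr addrA subrK mulrzr mulrzA.
    by apply: idlD; [apply: idlMr|apply: MM].
have GM : ideal_gen [set x; y] `<=` M.
  by apply: xy_sub; [apply: pxy_x|apply: pxy_y].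
apply: (p_xy2_sub (J := Ideal T_ideal)) => [|u v /GM Mu /GM Mv].
  by exists 1; rewrite mulr1z subrr; apply: idl0.
by exists 0; rewrite mulr0z subr0; apply: MM.
Qed.

(** Since [p * z] lies in [M^2], multiplying by an inverse [l] of [d] modulo [p] recovers [z] modulo
    [M^2]. *)
Lemma subring_lift (T : set S) (z q : S) (d : int) : prime p -> subringP T ->
  ~~ (p %| d)%Z -> M z -> T (z *~ d + q) -> ideal_exp M 2 q ->
  exists2 u, T u & ideal_exp M 2 (z - u).
Proof.
move=> p_prime ringT pd Mz Tzq Mq; have [[k l] /= kl] := int_bezout p_prime pd.
suff zu : ideal_exp M 2 (z - (z *~ d + q) *~ l).
  by exists ((z *~ d + q) *~ l); first exact: subringPz.
rewrite -[X in X - _](mulr1z z) -kl mulrzDr mulrzDl -[z *~ d *~ l]mulrzA.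
rewrite [(l * d)%R]mulrC opprD addrA addrK; apply: idlB; last exact: idlMz.
rewrite [(k * p%:Z)%R]mulrC mulrzA; apply: idlMz; rewrite -pmulrn -mulr_natl.
by apply: ideal_mulM; [apply: pxy_p|apply: ideal_exp1].
Qed.

End Nilpotent.

(** * Rings in which [(p, x, y)] annihilates [[x, y]] *)

Section CentralBracket.
Variables (S : pzRingType) (x y : S) (p : nat).
Hypothesis gen : generated_by x y.
Local Notation c := (bracket x y).
Local Notation M := (ideal_pxy p x y).
Local Notation N := (ideal_p_xy2 p x y).
Hypotheses (p_prime : prime p) (cp : c *+ p = 0).
Hypotheses (xc : x * c = 0) (cx : c * x = 0) (yc : y * c = 0) (cy : c * y = 0).

(** As [x] and [y] kill [c] on both sides, every ring element acts on [c] as an integer. *)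
Lemma bracket_span_is_ideal : is_ideal [set r | exists k : int, r = c *~ k].
Proof.
have cr r : (exists k : int, r * c = c *~ k) /\ (exists k : int, c * r = c *~ k).
  move: r; apply: (gen (T := [set r | _ /\ _])).
  - split=> [|a b [[i ai] [j aj]] [[k bk] [l bl]]
              |a b [[i ai] [j aj]] [[k bk] [l bl]]].
    + by split; exists 1; rewrite ?mulr1 ?mul1r mulr1z.
    + split; [exists (i - k)|exists (j - l)]; rewrite mulrzBr.
        by rewrite mulrBl ai bk.
      by rewrite mulrBr aj bl.
    + split; [exists (i * k)|exists (j * l)]; rewrite mulrzA.
        by rewrite -mulrA bk mulrzAr ai.
      by rewrite mulrA aj mulrzAl bl mulrzAC.
  - by split; exists 0; rewrite ?xc ?cx mulr0z.
  - by split; exists 0; rewrite ?yc ?cy mulr0z.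
split=> [|_ _ [i ->] [j ->]|_ r [i ->]].
- by exists 0; rewrite mulr0z.
- by exists (i - j); rewrite mulrzBr.
- have [[k rk] [l lr]] := cr r; split.
    by exists (k * i); rewrite mulrzAr rk mulrzA.
  by exists (l * i); rewrite mulrzAl lr mulrzA.
Qed.
Definition bracket_span : ideal S := Ideal bracket_span_is_ideal.

Lemma bracket_gen_span r : ideal_gen [set c] r <-> exists k : int, r = c *~ k.
Proof.
split=> [|[k ->]]; last exact/idlMz/mem_ideal_gen.
apply: (ideal_gen_sub (J := bracket_span)) => _ ->.
by exists 1; rewrite mulr1z.
Qed.

(** The quotient by the span of [c] is generated by two commuting elements, hence commutative. *)
Lemma bracket_in_span a b : exists k : int, a * b - b * a = c *~ k.
Proof.
have c1 : bracket_span c by exists 1; rewrite mulr1z.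
have /(quotr_comm _ gen) comm := c1.
suff : bracket_span (a * b - b * a) by [].
by apply/quotr_piP; rewrite !rmorphM.
Qed.

Lemma bracket_ann_is_ideal : is_ideal [set a | a * c = 0 /\ c * a = 0].
Proof.
have [_ _ span] := bracket_span_is_ideal.
have c1 : [set r | exists k : int, r = c *~ k] c by exists 1; rewrite mulr1z.
split=> [|a b [ac ca] [bc cb]|a r [ac ca]].
- by split; rewrite ?mul0r ?mulr0.
- by split; [rewrite mulrBl ac bc subrr|rewrite mulrBr ca cb subrr].
- have [[k rk] [l lr]] := span c r c1; split; split.
  + by rewrite -mulrA ac mulr0.
  + by rewrite mulrA lr mulrzAl ca mul0rz.
  + by rewrite -mulrA rk mulrzAr ac mul0rz.
  + by rewrite mulrA ca mul0r.
Qed.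
Definition bracket_ann : ideal S := Ideal bracket_ann_is_ideal.

Lemma pxy_bracket a : M a -> a * c = 0 /\ c * a = 0.
Proof.
suff : M `<=` bracket_ann by apply.
by apply: pxy_sub; split=> //; rewrite ?mulr_natl ?mulr_natr.
Qed.

(** Commutators are multiples of [c]. Those of multiples of [p] vanish because [p * c = 0]; in a
    product of two elements of [M], moving [r] past one factor produces a multiple of [c] that the
    other factor kills. *)
Lemma p_xy2_central v r : N v -> v * r = r * v.
Proof.
(* Centrality is required of all [a * v * b], which makes [T] an ideal. *)
pose T : set S := [set v | forall a b r, a * v * b * r = r * (a * v * b)].
have T_ideal : is_ideal T.
  split=> [a b s|u w Tu Tw a b s|u t Tu].
  - by rewrite !mulr0 !mul0r mulr0.
  - by rewrite mulrBr !mulrBl mulrBr Tu Tw.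
  - by split=> a b s; [have := Tu (a * t) b s|have := Tu a (t * b) s];
      rewrite !mulrA.
suff /[apply] /(_ 1 1 r) : N `<=` T by rewrite mul1r mulr1.
have comm a b : exists k : int, a * b = b * a + c *~ k.
  by have [k E] := bracket_in_span a b; exists k; rewrite -E addrC subrK.
apply: (p_xy2_sub (J := Ideal T_ideal)) => [a b s|a b Ga Gb d e s] /=.
  rewrite mulr_natr !mulrnAl mulrnAr; have [k ->] := comm (a * b) s.
  by rewrite mulrnDl (pmulrn (c *~ k)) mulrzAC -pmulrn cp mul0rz addr0.
have GM : ideal_gen [set x; y] `<=` M.
  by apply: xy_sub; [apply: pxy_x|apply: pxy_y].
have [/GM Ma /GM Mb] := conj Ga Gb.
have -> : d * (a * b) * e * s = (d * a) * (b * e * s) by rewrite !mulrA.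
have [k ->] := comm (b * e) s; have [l E] := comm (d * a) s.
have [dac _] := pxy_bracket (idlMl d Ma).
have [_ cbe] := pxy_bracket (idlMr e Mb).
rewrite mulrDr mulrzAr dac mul0rz addr0 mulrA E mulrDl mulrzAl cbe mul0rz addr0.
by rewrite !mulrA.
Qed.

Lemma bracket_mulz_eq0 (k : int) : (p %| k)%Z -> c *~ k = 0.
Proof. by case/dvdzP => l ->; rewrite mulrzA mulrzAC -pmulrn cp mul0rz. Qed.

Lemma bracket_mulzK (k : int) : ~~ (p %| k)%Z -> exists e : int, c *~ k *~ e = c.
Proof.
move=> /(int_bezout p_prime) [[u v] /= uv].
exists v; rewrite -mulrzA [(k * v)%R]mulrC -[RHS]mulr1z -uv mulrzDr.
by rewrite [X in _ = X + _]bracket_mulz_eq0 ?add0r // dvdz_mull.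
Qed.

(** Integers and elements of [N] are central, so only the linear parts contribute, through their
    determinant. *)
Lemma bracket_affine (i j k i' j' k' : int) v v' : N v -> N v' ->
  bracket (i%:~R + (x *~ j + y *~ k) + v) (i'%:~R + (x *~ j' + y *~ k') + v')
    = c *~ (j * k' - k * j').
Proof.
have bD a b d : bracket (a + b) d = bracket a d + bracket b d.
  by rewrite /bracket mulrDl mulrDr opprD addrACA.
have bDr a b d : bracket d (a + b) = bracket d a + bracket d b.
  by rewrite /bracket mulrDl mulrDr opprD addrACA.
have b0 a b : a * b = b * a -> bracket a b = 0.
  by rewrite /bracket => ->; rewrite subrr.
have bz a b (m : int) : bracket (a *~ m) b = bracket a b *~ m.
  by rewrite /bracket mulrzAl mulrzAr mulrzBl.
have bzr a b (m : int) : bracket a (b *~ m) = bracket a b *~ m.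
  by rewrite /bracket mulrzAl mulrzAr mulrzBl.
move=> Nv Nv'; rewrite !bD !bDr !bz !bzr.
have -> : bracket y x = - c by rewrite /bracket opprB.
rewrite [bracket x x]subrr [bracket y y]subrr !mul0rz.
have one a : bracket 1 a = 0 by rewrite b0 // mul1r mulr1.
have oner a : bracket a 1 = 0 by rewrite b0 // mul1r mulr1.
have vl a : bracket v a = 0 by exact/b0/p_xy2_central.
have v'r a : bracket a v' = 0 by apply/b0/esym/p_xy2_central.
rewrite !one !oner !vl !v'r.
by rewrite !mul0rz !addr0 !add0r mulrzBr !mulNrz
  [(j * k')%R]mulrC [(k * j')%R]mulrC !mulrzA.
Qed.


Lemma bracket_mulz_neq0 (k : int) : c *~ k != 0 -> ~~ (p %| k)%Z.
Proof. by apply: contraNN => /bracket_mulz_eq0 ->. Qed.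

Variable n : nat.
Hypothesis M_nil : forall a, ideal_exp M n a -> a = 0.

(** A nonzero commutator means that the determinant of the linear parts of [a] and [b] is prime to
    [p]; inverting it yields lifts of [x] and [y] modulo [M^2] in [T]. *)
Lemma subring_comm_or_full (T : set S) a b : subringP T -> T a -> T b ->
  a * b != b * a -> forall r, T r.
Proof.
move=> ringT Ta Tb ab; have [T1 TB _] := ringT.
have [i [j [k [v Nv aE]]]] := decomposition gen p a.
have [i' [j' [k' [v' Nv' bE]]]] := decomposition gen p b.
have pd : ~~ (p %| j * k' - k * j')%Z.
  apply: bracket_mulz_neq0.
  by rewrite -(bracket_affine i j k i' j' k' Nv Nv') -aE -bE subr_eq0.
have [l Mv] := p_xy2_coset gen Nv; have [l' Mv'] := p_xy2_coset gen Nv'.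
have TZ (m : int) : T m%:~R by apply: subringPz.
(* Integers lie in [T], so the constant terms and the multiples of [p] can be subtracted from [a]
   and [b], leaving errors in [M^2]. *)
have Tp (m : int) : T (p%:R *~ m) by apply: subringPz => //; exact: (TZ p).
set q := v - _ in Mv; set q' := v' - _ in Mv'.
have Ta0 : T (x *~ j + y *~ k + q).
  suff <- : a - i%:~R - p%:R *~ l = x *~ j + y *~ k + q.
    by apply: (TB) => //; apply: (TB).
  by rewrite aE -(addrA i%:~R) [i%:~R + _]addrC addrK -addrA.
have Tb0 : T (x *~ j' + y *~ k' + q').
  suff <- : b - i'%:~R - p%:R *~ l' = x *~ j' + y *~ k' + q'.
    by apply: (TB) => //; apply: (TB).
  by rewrite bE -(addrA i'%:~R) [i'%:~R + _]addrC addrK -addrA.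
move: q q' Mv Mv' Ta0 Tb0 => q q' Mq Mq' Ta0 Tb0.
(* Cramer's rule: eliminating [y] leaves the determinant times [x], and symmetrically for [y]
   below. *)
have [u Tu xu] : exists2 u, T u & ideal_exp M 2 (x - u).
  apply: (subring_lift p_prime ringT pd (q := q *~ k' - q' *~ k)).
  - exact: pxy_x.
  - suff -> : x *~ (j * k' - k * j') + (q *~ k' - q' *~ k)
       = (x *~ j + y *~ k + q) *~ k' - (x *~ j' + y *~ k' + q') *~ k.
      by apply: TB; apply: subringPz.
    rewrite !mulrzDl opprD addrACA; congr (_ + _).
    rewrite opprD addrACA -!mulrzA [(k' * k)%R]mulrC subrr addr0.
    by rewrite mulrzBr [(k * j')%R]mulrC.
  - by apply: idlB; apply: idlMz.
have [w Tw yw] : exists2 w, T w & ideal_exp M 2 (y - w).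
  apply: (subring_lift p_prime ringT pd (q := q' *~ j - q *~ j')).
  - exact: pxy_y.
  - suff -> : y *~ (j * k' - k * j') + (q' *~ j - q *~ j')
       = (x *~ j' + y *~ k' + q') *~ j - (x *~ j + y *~ k + q) *~ j'.
      by apply: TB; apply: subringPz.
    rewrite !mulrzDl opprD addrACA; congr (_ + _).
    rewrite opprD addrACA -!mulrzA [(j' * j)%R]mulrC subrr add0r.
    by rewrite mulrzBr [(j * k')%R]mulrC.
  - by apply: idlB; apply: idlMz.
exact: (subring_full gen M_nil ringT Tu Tw).
Qed.

(** A quotient is commutative exactly when the ideal contains [c], and proper subrings are
    commutative by [subring_comm_or_full]. *)
Lemma minimal_noncommutativeP : minimal_noncommutative S <->
  c != 0 /\ forall (J : ideal S) a, J a -> a != 0 -> J c.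
Proof.
split=> [[ncomm _ Jcomm]|[c0 Jc]].
  split=> [|J a Ja a0]; last by apply/(quotr_comm J gen)/Jcomm; exists a.
  apply: contra_notN ncomm; rewrite subr_eq0 => /eqP.
  exact: generated_comm.
split=> [comm|T [T1 TB TM] [a aT] u v uT vT|J [a Ja a0]].
- by move: c0; rewrite /bracket comm subrr eqxx.
- apply/eqP/negPn/negP => uv; case/negP: aT.
  by apply: (subring_comm_or_full (T := fun r => r \in T)) uv a.
- exact/(quotr_comm J gen)/(Jc J a).
Qed.

End CentralBracket.

(** * Isomorphisms with quotients and auxiliary facts on quotient rings *)

Lemma surj_ring_isomorphic (S R : pzRingType) (h : {rmorphism S -> R})
    (J : ideal S) : (forall r, exists a, h a = r) ->
  (forall a, h a = 0 <-> J a) -> ring_isomorphic R (quotr J).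
Proof.
move=> h_surj h_ker; have [g gE] := choice h_surj.
have hJ a b : h a = h b <-> quotr_pi J a = quotr_pi J b.
  by rewrite quotr_piP -h_ker rmorphB; split=> [->|/subr0_eq //]; rewrite subrr.
(* The class of the chosen preimage does not depend on the choice, by [hJ]. *)
pose k r := quotr_pi J (g r).
have kzmod : zmod_morphism k.
  by move=> r s; rewrite /k -rmorphB; apply/hJ; rewrite rmorphB !gE.
have kmonoid : monoid_morphism k.
  split=> [|r s]; rewrite /k.
    by rewrite -(rmorph1 (quotr_pi J)); apply/hJ; rewrite gE rmorph1.
  by rewrite -rmorphM; apply/hJ; rewrite rmorphM !gE.
pose kM : {rmorphism R -> quotr J} :=
  HB.pack k (GRing.isZmodMorphism.Build _ _ k kzmod)
            (GRing.isMonoidMorphism.Build _ _ k kmonoid).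
exists kM.
exists (fun u => h (quotr_repr u)) => [r|u] /=; rewrite /k.
  by rewrite -[RHS]gE; apply/hJ; rewrite quotr_reprK.
by rewrite -[RHS]quotr_reprK; apply/hJ; rewrite gE.
Qed.

Lemma rmorph_bracket (S S' : pzRingType) (h : {rmorphism S -> S'}) a b :
  h (bracket a b) = bracket (h a) (h b).
Proof. by rewrite /bracket rmorphB !rmorphM. Qed.

Lemma quotr_bracket_annihilated (S : pzRingType) (x y : S) p (J : ideal S)
    (u := quotr_pi J x) (v := quotr_pi J y) :
    (forall a, ideal_pxy p x y a ->
       J (a * bracket x y) /\ J (bracket x y * a)) ->
  [/\ bracket u v *+ p = 0, u * bracket u v = 0, bracket u v * u = 0,
      v * bracket u v = 0 & bracket u v * v = 0].
Proof.
move=> Jc; rewrite -rmorph_bracket.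
have [Jp _] := Jc _ (@pxy_p _ p x y).
have [Jxl Jxr] := Jc _ (@pxy_x _ p x y).
have [Jyl Jyr] := Jc _ (@pxy_y _ p x y).
rewrite -rmorphMn -!rmorphM -mulr_natl.
by split; apply/quotr_pi0.
Qed.

Lemma quotr_mulC (S : comPzRingType) (J : ideal S) :
  commutative ( *%R : quotr J -> quotr J -> quotr J).
Proof.
by move=> u v; rewrite -(quotr_reprK u) -(quotr_reprK v) -!rmorphM mulrC.
Qed.

Lemma colon_is_ideal (S : pzRingType) (J : ideal S) w :
  commutative ( *%R : S -> S -> S) -> is_ideal [set u | J (u * w)].
Proof.
move=> comm; split=> [|u v Ju Jv|u r Ju] /=.
- by rewrite mul0r; apply: idl0.
- by rewrite mulrBl; apply: idlB.
- by rewrite (comm u r) -mulrA; split; apply: idlMl.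
Qed.

Lemma intr_Fp_eq0 p (k : int) : prime p -> (k%:~R == 0 :> 'F_p) = (p %| k)%Z.
Proof. by move=> p_prime; rewrite (dvdz_pcharf (pchar_Fp p_prime)). Qed.

(* For P = ringP p n, X = xP p n and Y = yP p n this is [minimal_generating]. *)
Definition minimal_pair (P : pzRingType) (X Y : P) (p n : nat)
    (b : set P) (nu : P -> 'F_p) : Prop :=
  let M := ideal_pxy p X Y in
  let N := ideal_p_xy2 p X Y in
  [/\ [/\ is_ideal b, ideal_exp M n.-1 `<=` b & b `<=` N],
      (forall u v, b u -> b v -> nu (u + v) = nu u + nu v) /\
        (forall u, ideal_mul b M u -> nu u = 0)
    & forall u, N u -> (forall v, M v -> b (u * v)) ->
        b u \/ [\/ nu (p%:R * u) != 0, nu (X * u) != 0 | nu (Y * u) != 0]].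

(** * Correspondence between minimality of the ring and the conditions on the pair *)

(* The ring A enters only through the additive map phi = f o iota, which is
   multiplicative up to multiples of c = [x, y]. *)
Section ImagePair.
Variables (p n : nat) (P R : pzRingType) (X Y : P) (x y : R).
Variable phi : {additive P -> R}.
Local Notation c := (bracket x y).
Local Notation MP := (ideal_pxy p X Y).
Local Notation NP := (ideal_p_xy2 p X Y).
Local Notation MR := (ideal_pxy p x y).
Local Notation NR := (ideal_p_xy2 p x y).
Hypotheses (p_prime : prime p) (n_ge3 : (3 <= n)%N).
Hypotheses (P_comm : commutative ( *%R : P -> P -> P)).
Hypotheses (genP : generated_by X Y) (gen : generated_by x y).
Hypothesis P_nil : forall u, ideal_exp MP n u -> u = 0.
Hypothesis R_nil : forall r, ideal_exp MR n r -> r = 0.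
Hypotheses (cp : c *+ p = 0).
Hypotheses (xc : x * c = 0) (cx : c * x = 0) (yc : y * c = 0) (cy : c * y = 0).
Hypotheses (phi1 : phi 1 = 1) (phi_XM : forall u, phi (X * u) = x * phi u).
Hypothesis phi_YM : forall u, phi (Y * u) = phi u * y.

Let phi_pM u : phi (p%:R * u) = p%:R * phi u.
Proof. by rewrite !mulr_natl raddfMn. Qed.

Let phi_p : phi p%:R = p%:R.
Proof. by rewrite -[in LHS](mulr1 p%:R) phi_pM phi1 mulr1. Qed.

Let phi_X : phi X = x. Proof. by rewrite -[X]mulr1 phi_XM phi1 mulr1. Qed.
Let phi_Y : phi Y = y. Proof. by rewrite -[Y]mulr1 phi_YM phi1 mul1r. Qed.

Let span_ideal r : ideal_gen [set c] r <-> exists k : int, r = c *~ k.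
Proof. exact: bracket_gen_span. Qed.

Let central v r : NR v -> v * r = r * v.
Proof. exact: p_xy2_central. Qed.

Let p_xy2_c : NR c.
Proof.
rewrite /bracket; apply: idlB.
  by apply: p_xy2_M; [apply: xy_x|apply: xy_y].
by apply: p_xy2_M; [apply: xy_y|apply: xy_x].
Qed.

Let NR_c v : NR v -> v * c = 0.
Proof. by move=> /p_xy2_sub_pxy /(pxy_bracket gen cp xc cx yc cy) []. Qed.

(** Although [phi] need not be multiplicative, multiplying by [X] or [Y] becomes multiplication by
    [x] on the left or by [y] on the right, and [J] is two-sided. *)
Lemma phi_preim_is_ideal (J : ideal R) : is_ideal [set u | J (phi u)].
Proof.
have JM r : forall u, J (phi u) -> J (phi (r * u)).
  move: r; apply: (genP (T := [set r | forall u, J (phi u) -> J (phi (r * u))])).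
  - split=> [u|a b Ja Jb u Ju|a b Ja Jb u Ju].
    + by rewrite mul1r.
    + by rewrite mulrBl raddfB; apply: idlB; [apply: Ja|apply: Jb].
    + by rewrite -mulrA; apply/Ja/Jb.
  - by move=> u Ju; rewrite phi_XM; apply: idlMl.
  - by move=> u Ju; rewrite phi_YM; apply: idlMr.
split=> [|u v Ju Jv|u r Ju] /=.
- by rewrite raddf0; apply: idl0.
- by rewrite raddfB; apply: idlB.
- by rewrite (P_comm u r); split; apply: JM.
Qed.
Let phi_preim (J : ideal R) : ideal P := Ideal (phi_preim_is_ideal J).
Let colon (J : ideal P) w : ideal P := Ideal (colon_is_ideal J w P_comm).

Lemma phi_p_xy2 v : NP v -> NR (phi v).
Proof.
have GP u : ideal_gen [set X; Y] u -> ideal_gen [set x; y] (phi u).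
  apply: (xy_sub (J := phi_preim (ideal_gen [set x; y]))) => /=.
    by rewrite phi_X; apply: xy_x.
  by rewrite phi_Y; apply: xy_y.
apply: (p_xy2_sub (J := phi_preim NR)) => [|u w Gu Gw].
  by suff : NR (phi p%:R) by []; rewrite phi_p; apply: p_xy2_p.
apply: (xy_sub (J := colon (phi_preim NR) w)) Gu.
  suff : NR (phi (X * w)) by [].
  by rewrite phi_XM; apply: p_xy2_M; [apply: xy_x|apply: GP].
suff : NR (phi (Y * w)) by [].
by rewrite phi_YM; apply: p_xy2_M; [apply: GP|apply: xy_y].
Qed.

(** A factor [X] is treated exactly; a factor [Y] puts [y] on the other side, at the cost of a
    commutator, which is a multiple of [c]. *)
Lemma phiM u v : exists k : int, phi (u * v) - phi u * phi v = c *~ k.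
Proof.
pose I := ideal_gen [set c].
suff phiMI u' : forall v', I (phi (u' * v') - phi u' * phi v').
  exact/span_ideal/phiMI.
move: u'; apply: (genP (T := [set a | forall b, I (phi (a * b) - phi a * phi b)])).
- split=> [w|a b Ia Ib w|a b Ia Ib w].
  + by rewrite mul1r phi1 mul1r subrr; apply: idl0.
  + by rewrite mulrBl !raddfB mulrBl subrACA; apply: idlB; [apply: Ia|apply: Ib].
  + rewrite -mulrA; have Iabw := Ia (b * w).
    have -> : phi (a * (b * w)) - phi (a * b) * phi w
        = phi (a * (b * w)) - phi a * phi (b * w)
          + phi a * (phi (b * w) - phi b * phi w)
          - (phi (a * b) - phi a * phi b) * phi w.
      by rewrite mulrBr mulrBl addrA subrK [phi a * (_ * _)]mulrA opprB addrA subrK.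
    by apply: idlB; [apply: idlD => //; apply/idlMl/Ib|apply/idlMr/Ia].
- by move=> w; rewrite phi_XM phi_X subrr; apply: idl0.
- by move=> w; rewrite phi_YM phi_Y; apply/span_ideal/bracket_in_span.
Qed.

(** By [phiM] the elements of this form are closed under products, hence form a subring containing
    [x] and [y]. *)
Lemma phi_span r : exists u (k : int), r = phi u + c *~ k.
Proof.
move: r; apply: (gen (T := [set r | exists u (k : int), r = phi u + c *~ k])).
- split=> [|a b [u [k ->]] [v [l ->]]|a b [u [k ->]] [v [l ->]]].
  + by exists 1, 0; rewrite phi1 mulr0z addr0.
  + by exists (u - v), (k - l); rewrite raddfB mulrzBr opprD addrACA.
  + have [m E] := phiM u v; exists (u * v).
    have /span_ideal [l' E'] :
        ideal_gen [set c] ((phi u + c *~ k) * (phi v + c *~ l) - phi (u * v)).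
      have cc : ideal_gen [set c] c by apply: mem_ideal_gen.
      have -> : (phi u + c *~ k) * (phi v + c *~ l) - phi (u * v)
          = - (phi (u * v) - phi u * phi v)
            + (phi u * (c *~ l) + (c *~ k) * (phi v + c *~ l)).
        rewrite mulrDl [phi u * _]mulrDr opprB -!addrA.
        by rewrite [- phi (u * v) + _]addrC !addrA.
      rewrite E; apply: idlD; first exact/idlN/idlMz.
      by apply: idlD; [apply/idlMl/idlMz|apply/idlMr/idlMz].
    by exists l'; rewrite -E' [RHS]addrC subrK.
- by exists X, 0; rewrite phi_X mulr0z addr0.
- by exists Y, 0; rewrite phi_Y mulr0z addr0.
Qed.


Lemma bracket_mulz_dvd (k : int) : c != 0 -> c *~ k = 0 -> (p %| k)%Z.
Proof.
move=> c0 ck; apply: contraR c0 => /(bracket_mulzK p_prime cp) [e].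
by rewrite ck mul0rz => <-.
Qed.

(** The products of [s] with [c] and its brackets with [x] and [y] detect, modulo [p], the constant
    and linear coefficients of [u]; all three vanish. *)
Lemma mem_p_xy2 u (m : int) (s := phi u + c *~ m) :
  c != 0 -> s * x = x * s -> s * y = y * s -> s * c = 0 -> NP u.
Proof.
move=> c0 sx sy sc; have [i [j [k [v Nv uE]]]] := decomposition genP p u.
have NV : NR (phi v + c *~ m) by apply: idlD; [apply: phi_p_xy2|apply/idlMz/p_xy2_c].
have sE : s = i%:~R + (x *~ j + y *~ k) + (phi v + c *~ m).
  by rewrite /s uE !raddfD /= !raddfMz phi1 phi_X phi_Y -[LHS]addrA.
have N0 : NR 0 by apply: idl0.
have bs j' k' : bracket s (0%:~R + (x *~ j' + y *~ k') + 0)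
    = c *~ (j * k' - k * j').
  by rewrite sE (bracket_affine gen cp xc cx yc cy).
have pdvd z l : (p %| l)%Z -> NP (z *~ l).
  case/dvdzP => q ->; rewrite mulrC mulrzA -pmulrn -mulr_natl.
  by apply/idlMz/idlMr/p_xy2_p.
have [pi pj pk] : [/\ (p %| i)%Z, (p %| j)%Z & (p %| k)%Z].
  split; apply: bracket_mulz_dvd => //.
  - have /NR_c Vc := NV; move: sc; rewrite sE !mulrDl !mulrzAl mul1r xc yc.
    by rewrite -mulrzAl -[phi v * c + _]mulrDl Vc !mul0rz !addr0.
  - by have := bs 0 1; rewrite !mulr0z mulr1z add0r add0r addr0 /bracket sy
      subrr mulr1 mulr0 subr0 => <-.
  - have := bs (-1) 0; rewrite !mulr0z mulrN1z add0r !addr0 /bracket mulrN mulNr.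
    by rewrite sx subrr mulr0 mulrN1 opprK add0r => <-.
by rewrite uE; apply: idlD Nv; apply: idlD; [|apply: idlD]; apply: pdvd.
Qed.

(** Here [r = phi u] is central and killed by [M], so its integer multiples form an ideal. If [r] is
    nonzero this ideal contains [c], and the coefficient is invertible modulo [p] because
    [p * r = 0] and [c != 0]. *)
Lemma phi_socle u : (forall (J : ideal R) a, J a -> a != 0 -> J c) -> c != 0 ->
  NP u -> phi (p%:R * u) = 0 -> phi (X * u) = 0 -> phi (Y * u) = 0 ->
  exists k : int, phi u = c *~ k.
Proof.
move=> Jc c0 Nu; set r := phi u.
rewrite phi_pM phi_XM phi_YM -/r => pr xr ry.
have r_central := central _ (phi_p_xy2 Nu); rewrite -/r in r_central.
have ann_ideal : is_ideal [set a | a * r = 0].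
  split=> [|a b /= ar br|a t /= ar]; first by rewrite /= mul0r.
    by rewrite mulrBl ar br subrr.
  split; first by rewrite -mulrA ar mulr0.
  by rewrite -mulrA -(r_central t) mulrA ar mul0r.
have Mr a : MR a -> a * r = 0.
  apply: (pxy_sub (J := Ideal ann_ideal)) => //=.
  by rewrite -r_central.
have rJ_ideal : is_ideal [set s | exists k : int, s = r *~ k].
  split=> [|_ _ [k ->] [l ->]|_ t [k ->]].
  - by exists 0; rewrite mulr0z.
  - by exists (k - l); rewrite mulrzBr.
  - have [i /Mr ti] := pxy_coset gen p t.
    have tr : t * r = r *~ i.
      by apply/eqP; rewrite -subr_eq0 -mulrzl -mulrBl ti.
    by split; exists (i * k); rewrite ?mulrzAr ?mulrzAl ?r_central tr mulrzA.
have [->|r0] := eqVneq r 0; first by exists 0; rewrite mulr0z.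
have [k cE] : exists k : int, c = r *~ k.
  by apply: (Jc (Ideal rJ_ideal) r) => //; exists 1; rewrite mulr1z.
have rp : r *~ p%:Z = 0 by rewrite -pmulrn -mulr_natl.
have pk : ~~ (p %| k)%Z.
  apply: contra_neqN c0 => /dvdzP [q qE].
  by rewrite cE qE mulrC mulrzA rp mul0rz.
have [[a b] /= ab] := int_bezout p_prime pk.
by exists b; rewrite cE -mulrzA -[LHS]mulr1z -ab mulrzDr [(b * k)%R]mulrC
  [(a * _)%R]mulrC (mulrzA r p%:Z) rp mul0rz add0r.
Qed.

Lemma pxy_exp_mem_p_xy2 k u : (2 <= k)%N -> ideal_exp MP k u -> NP u.
Proof. by move=> k2 /(ideal_exp_le k2); apply: pxy_exp2_sub. Qed.

Variables (A : set P) (mu : P -> 'F_p).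
Hypothesis A_span : forall u, A u <-> exists k : int, phi u = c *~ k.
Hypothesis mu0 : c = 0 -> forall u, mu u = 0.
Hypothesis muE : c != 0 -> forall u (k : int), phi u = c *~ k -> mu u = k%:~R.

Lemma pair_is_ideal : is_ideal A.
Proof.
have -> : A = phi_preim (ideal_gen [set c]).
  by apply/funext => u; apply/propext; rewrite A_span -span_ideal.
exact: idealP.
Qed.
Let AI : ideal P := Ideal pair_is_ideal.

(** [mu] reads the coefficient of [c] modulo [p], and [p * c = 0]. *)
Lemma mu_eq0 u : c != 0 -> A u -> mu u = 0 -> phi u = 0.
Proof.
move=> c0 /A_span [k uk] /eqP; rewrite (muE c0 uk) intr_Fp_eq0 // uk => pk.
exact: (bracket_mulz_eq0 cp).
Qed.

Lemma phi_eq0_mu u : phi u = 0 -> A u /\ mu u = 0.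
Proof.
move=> u0; split; first by apply/A_span; exists 0; rewrite mulr0z.
have [/mu0 //|c0] := eqVneq c 0.
by rewrite (muE c0 (k := 0)) // u0 mulr0z.
Qed.

Lemma mul_pxy_sub (J : ideal P) u : J (p%:R * u) -> J (X * u) -> J (Y * u) ->
  forall v, MP v -> J (u * v).
Proof.
move=> Jp JX JY v; rewrite P_comm.
by apply: (pxy_sub (J := colon J u)).
Qed.

Lemma minimal_noncommutative_pair :
  minimal_noncommutative R -> minimal_pair X Y n A mu.
Proof.
move=> /(minimal_noncommutativeP gen p_prime cp xc cx yc cy R_nil) [c0 Jc].
have kerA (w : P) : phi w = 0 -> A w by move=> /phi_eq0_mu [].
split.
- split; first exact: pair_is_ideal.
    (* As [M^n = 0], elements of [M^(n-1)] are killed by [M]; [n >= 3] places them in [N], so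
       [phi_socle] applies. *)
    move=> u Mu; have n2 : (2 <= n.-1)%N by case: n n_ge3 => [|[]].
    have kill w : MP w -> phi (w * u) = 0.
      move=> Mw; rewrite (P_nil (u := w * u)) ?raddf0 //.
      by rewrite -(ltn_predK n_ge3); apply: ideal_mulM.
    apply/A_span/phi_socle => //.
    + exact: pxy_exp_mem_p_xy2 n2 Mu.
    + exact/kill/pxy_p.
    + exact/kill/pxy_x.
    + exact/kill/pxy_y.
  (* A multiple of [c] commutes with [x] and [y] and kills [c], so [mem_p_xy2] applies with zero
     correction. *)
  move=> u /A_span [k uk]; apply: (mem_p_xy2 (m := 0)) => //;
    rewrite mulr0z addr0 uk ?mulrzAl ?mulrzAr ?xc ?cx ?yc ?cy //.
  by rewrite NR_c // mul0rz.
- split=> [u v /A_span [k uk] /A_span [l vl]|u].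
    rewrite (muE c0 uk) (muE c0 vl) -intrD; apply: muE => //.
    by rewrite raddfD /= uk vl mulrzDr.
  (* [phi] maps [A] to multiples of [c], which the generators annihilate; so [phi] vanishes on the
     product ideal. *)
  suff ker : ideal_mul A MP `<=` phi_preim (Ideal (@zero_is_ideal R)).
    by move=> /ker /phi_eq0_mu [].
  apply: ideal_gen_sub => _ [a /A_span [k ak] [v Mv <-]].
  apply: mul_pxy_sub Mv => /=.
  + by rewrite phi_pM ak mulrzAr mulr_natl cp mul0rz.
  + by rewrite phi_XM ak mulrzAr xc mul0rz.
  + by rewrite phi_YM ak mulrzAl cy mul0rz.
- move=> u Nu MuA; have Mu w : MP w -> A (w * u) by rewrite P_comm; apply: MuA.
  (* If all three values of [mu] vanish, so do the corresponding images under [phi], and [phi_socle]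
     gives membership. *)
  have [m1|m1] := eqVneq (mu (p%:R * u)) 0; last by right; apply: Or31.
  have [m2|m2] := eqVneq (mu (X * u)) 0; last by right; apply: Or32.
  have [m3|m3] := eqVneq (mu (Y * u)) 0; last by right; apply: Or33.
  left; apply/A_span/phi_socle => //; apply: mu_eq0 => //; apply: Mu.
  + exact: pxy_p.
  + exact: pxy_x.
  + exact: pxy_y.
Qed.

(** The hypothesis for [c = 0] encodes the exclusion of [Z[x, y] / ((p) + (x, y)^2)];
    [image_isomorphic] makes the link. *)
Lemma pair_minimal_noncommutative :
    (c = 0 -> ~ forall u, phi u = 0 <-> NP u) ->
  minimal_pair X Y n A mu -> minimal_noncommutative R.
Proof.
move=> c0_ker [[_ MA AN] _ A_socle].
apply/(minimal_noncommutativeP gen p_prime cp xc cx yc cy R_nil).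
(* If [c = 0], then [mu] vanishes and [A] is the kernel of [phi]; condition (3) enlarges what [A] is
   known to contain until [A = N], the excluded case. *)
have c0 : c != 0.
  apply/eqP => c0; apply: (c0_ker c0) => u.
  have A0 w : A w <-> phi w = 0.
    split=> [/A_span [k ->]|/phi_eq0_mu [] //]; by rewrite c0 mul0rz.
  rewrite -A0; split=> [|Nu]; first exact: AN.
  have up w : NP w -> (forall v, MP v -> A (w * v)) -> A w.
    move=> Nw /(A_socle w Nw) [//|].
    by rewrite !mu0 // eqxx; case.
  have descent d k : (k + d)%N = n.-1 -> (2 <= k)%N -> ideal_exp MP k `<=` A.
    elim: d k => [|d IHd] k; first by rewrite addn0 => ->.
    rewrite addnS -addSn => /IHd MkA k2 w Mw; apply: up => [|v Mv].
      exact: pxy_exp_mem_p_xy2 k2 Mw.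
    by apply: MkA; [apply: leqW|apply: ideal_expSr].
  (* The last step uses that [N * M] lies in [M^2], already known to be inside [A]. *)
  apply: up => // v Mv; apply: (descent (n.-1 - 2)%N 2) => //.
    by rewrite subnKC //; case: n n_ge3 => [|[]].
  by apply: ideal_mulM; [apply: p_xy2_sub_pxy|apply: ideal_exp1].
split=> // J a Ja a0; apply: contrapT => Jc.
(* An ideal without [c] meets the span of [c] trivially, because any nonzero multiple of [c] has [c]
   as a multiple. *)
have Jspan (k : int) : J (c *~ k) -> c *~ k = 0.
  move=> Jck; apply/eqP/negPn/negP => ck; apply: Jc.
  have [e <-] := bracket_mulzK p_prime cp (bracket_mulz_neq0 cp ck).
  exact: idlMz.
have [s [Js s0 ps xs ys]] := ideal_socle R_nil Ja a0.
(* Commutators of [s] lie both in [J] and in the span of [c], hence vanish. *)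
have s_central r : s * r = r * s.
  have [k E] := bracket_in_span gen xc cx yc cy s r.
  apply/eqP; rewrite -subr_eq0 E Jspan // -E.
  by apply: idlB; [apply: idlMr|apply: idlMl].
have sy : s * y = 0 by rewrite s_central.
have sc : s * c = 0.
  by rewrite /bracket mulrBr !mulrA sy s_central xs !mul0r subrr.
have [u [k sE]] := phi_span s.
have phi_u : phi u = s - c *~ k by rewrite sE addrK.
have Nu : NP u by apply: (mem_p_xy2 (m := k)); rewrite // -sE.
have u_p : phi (p%:R * u) = 0.
  by rewrite phi_pM phi_u mulrBr ps mulrzAr mulr_natl cp mul0rz subrr.
have u_X : phi (X * u) = 0.
  by rewrite phi_XM phi_u mulrBr xs mulrzAr xc mul0rz subrr.
have u_Y : phi (Y * u) = 0.
  by rewrite phi_YM phi_u mulrBl sy mulrzAl cy mul0rz subrr.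
have [Ap mp] := phi_eq0_mu u_p.
have [AX mX] := phi_eq0_mu u_X.
have [AY mY] := phi_eq0_mu u_Y.
have uM v : MP v -> A (u * v) by apply: (mul_pxy_sub (J := AI)).
(* Condition (3) makes [phi u], and with it [s], a multiple of [c]; lying in [J], it is zero,
   against [s0]. *)
have [/A_span [l ul]|] := A_socle u Nu uM; last by rewrite mp mX mY eqxx; case.
case/eqP: s0; rewrite sE ul -mulrzDr; apply: Jspan.
by rewrite mulrzDr -ul -sE.
Qed.

(** When [c = 0], [phi] is multiplicative by [phiM] and surjective by [phi_span]. *)
Lemma image_isomorphic (S : pzRingType) (h : {rmorphism S -> P}) (J : ideal S) :
    (forall u, exists a, h a = u) -> (forall a, NP (h a) <-> J a) ->
    c = 0 -> (forall u, phi u = 0 <-> NP u) ->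
  ring_isomorphic R (quotr J).
Proof.
move=> h_surj hJ c0 phi_ker.
have phi_monoid : monoid_morphism phi.
  split=> // u v; have [k /eqP] := phiM u v.
  by rewrite c0 mul0rz subr_eq0 => /eqP.
pose phi_rm : {rmorphism P -> R} :=
  HB.pack (phi : P -> R) (GRing.isZmodMorphism.Build _ _ phi (raddfB phi))
          (GRing.isMonoidMorphism.Build _ _ phi phi_monoid).
apply: (surj_ring_isomorphic (h := phi_rm \o h)) => [r|a] /=.
  have [u [k ->]] := phi_span r; have [a <-] := h_surj u.
  by exists a; rewrite c0 mul0rz addr0.
by rewrite -hJ -phi_ker.
Qed.

End ImagePair.

(** * Properties of the concrete rings [ringA] and [ringP] *)

Lemma quotr_pi_p_xy2 (S : pzRingType) (x y : S) p n a
    (J := ideal_exp (ideal_pxy p x y) n) : (2 <= n)%N ->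
  ideal_p_xy2 p (quotr_pi J x) (quotr_pi J y) (quotr_pi J a)
    <-> ideal_p_xy2 p x y a.
Proof.
move=> n2; split=> [/(image_p_xy2 (@quotr_pi_surj _ J)) [b Nb /esym /quotr_piP]|].
  (* With [n >= 2], the ideal [M^n] divided out is contained in [N]. *)
  by move=> /(ideal_exp_le n2) /pxy_exp2_sub; apply: idl_subr.
have sub : ideal_gen [set x; y]
    `<=` preim_ideal (quotr_pi J) (ideal_gen [set quotr_pi J x; quotr_pi J y]).
  by apply: xy_sub; [apply: xy_x|apply: xy_y].
pose N := ideal_p_xy2 p (quotr_pi J x) (quotr_pi J y).
suff : ideal_p_xy2 p x y `<=` preim_ideal (quotr_pi J) N by apply.
apply: p_xy2_sub => [|b d /sub Gb /sub Gd].
  suff : N (quotr_pi J p%:R) by [].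
  by rewrite rmorph_nat; apply: p_xy2_p.
suff : N (quotr_pi J (b * d)) by [].
by rewrite rmorphM; apply: p_xy2_M.
Qed.

Section RingA.
Variables p n : nat.

Lemma ringA_bracket (u := xA p n) (v := yA p n) :
  [/\ bracket u v *+ p = 0, u * bracket u v = 0, bracket u v * u = 0,
      v * bracket u v = 0 & bracket u v * v = 0].
Proof.
apply: quotr_bracket_annihilated => a Ma.
split; apply/ideal_addl; [apply: ideal_addl|apply: ideal_addr].
  by apply: mem_ideal_gen; exists a => //; exists 1; rewrite ?mulr1.
by apply: mem_ideal_gen; exists 1 => //; exists a; rewrite ?mul1r.
Qed.

Lemma generated_ringA : generated_by (xA p n) (yA p n).
Proof. exact: generated_by_surj (@quotr_pi_surj _ _) generated_freeZ. Qed.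

Lemma ringA_nil a : ideal_exp (ideal_pxy p (xA p n) (yA p n)) n a -> a = 0.
Proof.
move=> /(image_pxy_exp (@quotr_pi_surj _ _)) [g Mg <-].
exact/quotr_pi0/ideal_addr.
Qed.

Lemma generated_ringP : generated_by (xP p n) (yP p n).
Proof. exact: generated_by_surj (@quotr_pi_surj _ _) generated_polyZ. Qed.

Lemma ringP_comm : commutative ( *%R : ringP p n -> ringP p n -> ringP p n).
Proof. exact: quotr_mulC. Qed.

Lemma ringP_nil a : ideal_exp (ideal_pxy p (xP p n) (yP p n)) n a -> a = 0.
Proof.
by move=> /(image_pxy_exp (@quotr_pi_surj _ _)) [g Mg <-]; apply/quotr_pi0.
Qed.

End RingA.

(** * The pair associated to an image of [ringA] *)

Section AssociatedPair.
Variables (p n : nat) (R : pzRingType) (f : {rmorphism ringA p n -> R}).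

Lemma phi_pi g :
  f (iotaPA (quotr_pi _ g : ringP p n)) = eval2 (f (xA p n)) (f (yA p n)) g.
Proof. by rewrite iotaPA_pi eval2_rmorph. Qed.

Lemma phi_zmod : zmod_morphism (fun u : ringP p n => f (iotaPA u)).
Proof.
move=> u v; rewrite -(quotr_reprK u) -(quotr_reprK v) -rmorphB.
by rewrite !phi_pi raddfB.
Qed.

Definition phi : {additive ringP p n -> R} :=
  HB.pack (fun u : ringP p n => f (iotaPA u))
    (GRing.isZmodMorphism.Build _ _ _ phi_zmod).

Lemma phi_xM u : phi (xP p n * u) = f (xA p n) * phi u.
Proof. by rewrite -(quotr_reprK u) -rmorphM /= !phi_pi eval2_mulX. Qed.

Lemma phi_yM u : phi (yP p n * u) = phi u * f (yA p n).
Proof. by rewrite -(quotr_reprK u) -rmorphM /= !phi_pi eval2_mulY. Qed.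

Lemma phi1 : phi 1 = 1.
Proof. by rewrite /= (phi_pi 1) eval2U !cm1 mulr1 mulr1z. Qed.


Local Notation x := (f (xA p n)).
Local Notation y := (f (yA p n)).
Local Notation c := (bracket x y).
Hypothesis p_prime : prime p.
Hypothesis f_surj : forall r : R, exists a : ringA p n, f a = r.

Lemma generated_image : generated_by x y.
Proof. exact: generated_by_surj f_surj (@generated_ringA p n). Qed.

Lemma image_nil a : ideal_exp (ideal_pxy p x y) n a -> a = 0.
Proof.
by move=> /(image_pxy_exp f_surj) [b /ringA_nil -> <-]; rewrite rmorph0.
Qed.

Lemma image_bracket :
  [/\ c *+ p = 0, x * c = 0, c * x = 0, y * c = 0 & c * y = 0].
Proof.
rewrite -rmorph_bracket.
have [cp xc cx yc cy] := ringA_bracket p n.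
by split; rewrite -?rmorphMn -?rmorphM ?cp ?xc ?cx ?yc ?cy rmorph0.
Qed.

Lemma assoc_idealP u : assoc_ideal f u <-> exists k : int, phi u = c *~ k.
Proof.
have [cp xc cx yc cy] := image_bracket.
rewrite /assoc_ideal /mkset toCE quotr_pi0.
exact: (bracket_gen_span generated_image xc cx yc cy).
Qed.

Lemma assoc_map0 : c = 0 -> forall u, assoc_map f u = 0.
Proof. by move=> c0 u; rewrite /assoc_map /bracketR c0 eqxx. Qed.

(** A nonzero [c] has additive order [p], so its multiples determine their coefficients in
    ['F_p]. *)
Lemma assoc_mapE : c != 0 -> forall u (k : int),
  phi u = c *~ k -> assoc_map f u = k%:~R.
Proof.
move=> c0 u k uk; have [cp _ _ _ _] := image_bracket.
have eq_Fp (m : 'F_p) : (c *~ k == c *+ m) = (k%:~R == m).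
  rewrite -subr_eq0 pmulrn -mulrzBr -[in RHS]subr_eq0 -[m in RHS]natr_Zp.
  rewrite [(m : nat)%:R]pmulrn -intrB intr_Fp_eq0 //; apply/eqP/idP.
    exact: bracket_mulz_dvd.
  exact: (bracket_mulz_eq0 cp).
rewrite /assoc_map (negPf c0); case: pickP => [m|] /=.
  by rewrite [f _]uk eq_Fp => /eqP.
(* The default value of the search is never reached: the residue of [k] satisfies the test. *)
by move/(_ k%:~R); rewrite [f _]uk eq_Fp eqxx.
Qed.

End AssociatedPair.

Theorem theorem4p7 (p n : nat) (p_prime : prime p) (n_ge3 : (3 <= n)%N)
    (R : pzRingType) (f : {rmorphism ringA p n -> R})
    (f_surj : forall r : R, exists a : ringA p n, f a = r)
    (R_neq : ~ ring_isomorphic R (quotr (ideal_p_xy2 p xZ yZ))) :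
  minimal_noncommutative R <->
  minimal_generating (assoc_ideal f) (assoc_map f).
Proof.
have [cp xc cx yc cy] := image_bracket f.
have gen := generated_image f_surj; have R_nil := image_nil f_surj.
have P_comm := @ringP_comm p n; have P_nil := @ringP_nil p n.
have genP := @generated_ringP p n.
have phiX := @phi_xM p n R f; have phiY := @phi_yM p n R f.
have A_span := assoc_idealP f_surj; have muE := @assoc_mapE p n R f p_prime.
split.
  exact: (minimal_noncommutative_pair p_prime n_ge3 P_comm genP gen P_nil R_nil
    cp xc cx yc cy (phi1 f) phiX phiY A_span (@assoc_map0 _ _ _ f) muE).
apply: (pair_minimal_noncommutative p_prime n_ge3 P_comm genP gen R_nil
  cp xc cx yc cy (phi1 f) phiX phiY A_span (@assoc_map0 _ _ _ f) muE).
(* In this case [R] would be the excluded quotient, reached from [polyZ] through [ringP]. *)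
move=> c0 phi_ker; apply: R_neq.
pose h : {rmorphism polyZ -> ringP p n} :=
  quotr_pi (ideal_exp (ideal_pxy p xZ yZ) n).
have h_surj : forall u, exists a, h a = u by apply: quotr_pi_surj.
have iso := image_isomorphic genP gen xc cx yc cy (phi1 f) phiX phiY h_surj.
apply: iso c0 phi_ker => a.
exact/quotr_pi_p_xy2/ltnW.
Qed.
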